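(* Let $B$ be a finite connected $d$-regular graph with $d\ge3$. Then for every integer $j>0$ there exist $\epsilon>0$, $C>0$ and an integer $r$ such that: (1) if $B$ is not bipartite, the probability that $G\in\mathcal C_n(B)$ contains no connected component with fewer than $r$ vertices and has $|\lambda_i(G)|\ge d-\epsilon$ for some $i>1$ is at most $Cn^{-j}$; (2) if $B$ is bipartite, the same holds with the condition ''$i>1$'' replaced by ''$i\ne 1,|V_G|$''.
   Context: Graphs allow multiple edges, whole-loops and half-loops; the degree of a vertex is the number of directed edges with it as tail; $A_G$ is the adjacency matrix and $\lambda_1(G)\ge\lambda_2(G)\ge\cdots\ge\lambda_{|V_G|}(G)$ are its eigenvalues. $\mathcal C_n(B)$: for a permutation assignment $\sigma:E^{\mathrm{dir}}_B\to S_n$ ($\sigma(\iota e)=\sigma(e)^{-1}$), $B[\sigma]$ has vertices $V_B\times[n]$, directed edges $E^{\mathrm{dir}}_B\times[n]$, $t(e,i)=(t(e),i)$, $h(e,i)=(h(e),\sigma(e)i)$, $\iota(e,i)=(\iota e,\sigma(e)i)$; the $\sigma(e)$ are independent apart from $\sigma(\iota e)=\sigma(e)^{-1}$, uniform on $S_n$ for non-half-loops, and for a half-loop a uniform fixed-point-free involution ($n$ even) or uniform involution with exactly one fixed point ($n$ odd). *)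

(* Defs.v *)
From HB Require Import structures.
From mathcomp Require Import all_boot all_order all_algebra all_fingroup.
From mathcomp Require Import boolp reals.
Set Implicit Arguments. Unset Strict Implicit. Unset Printing Implicit Defensive.
Import Order.TTheory GRing.Theory Num.Theory.
Local Open Scope ring_scope.

(* A graph (multi-edges, whole-loops, half-loops allowed) is given by a finite
   vertex type V, a finite type E of directed edges, tail/head maps and an
   involution inv : E -> E with hd e = tl (inv e).  inv e = e : half-loop. *)

Section Graphs.
Variables (V E : finType) (tl hd : E -> V).

Definition gdeg (v : V) : nat := #|[set e | tl e == v]|.
Definition gregular (d : nat) : Prop := forall v, gdeg v = d.

Definition gadj : rel V := fun u v => [exists e, (tl e == u) && (hd e == v)].
Definition gconnected : Prop := forall u v, connect gadj u v.
Definition gbipartite : Prop := exists f : V -> bool, forall e, f (tl e) != f (hd e).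

Definition gadjmx (R : nzRingType) : 'M[R]_#|V| :=
  \matrix_(i, j) (#|[set e | (tl e == enum_val i) && (hd e == enum_val j)]|)%:R.

Definition no_small_component (r : nat) : Prop :=
  forall u : V, (r <= #|[set v | connect gadj u v]|)%N.
End Graphs.

Definition is_eigenseq (R : realType) (N : nat) (A : 'M[R]_N) (s : seq R) : Prop :=
  sorted (fun x y => y <= x) s /\ char_poly A = \prod_(x <- s) ('X - x%:P).

Section Lifts.
Variables (V E : finType) (tl hd : E -> V) (inv : E -> E) (n : nat).

Definition lift_tl (p : E * 'I_n) : V * 'I_n := (tl p.1, p.2).
Definition lift_hd (sigma : {ffun E -> {perm 'I_n}}) (p : E * 'I_n) : V * 'I_n :=
  (hd p.1, sigma p.1 p.2).
Definition lift_inv (sigma : {ffun E -> {perm 'I_n}}) (p : E * 'I_n) : E * 'I_n :=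
  (inv p.1, sigma p.1 p.2).

Definition perm_assignment (sigma : {ffun E -> {perm 'I_n}}) : bool :=
  [forall e, sigma (inv e) == (sigma e)^-1%g] &&
  [forall e, (inv e == e) ==>
     (((sigma e * sigma e)%g == 1%g) && (#|[set i | sigma e i == i]| == odd n))].

Definition assignments : {set {ffun E -> {perm 'I_n}}} :=
  [set sigma | perm_assignment sigma].

(* The distribution of C_n(B) (independent uniform choices as described) is the
   uniform distribution on admissible assignments. *)
Definition lift_prob (R : realType) (P : {ffun E -> {perm 'I_n}} -> Prop) : R :=
  (#|[set sigma in assignments | `[< P sigma >]]|)%:R / (#|assignments|)%:R.
End Lifts.

(* Main.v *)
Require Import Defs.
From HB Require Import structures.
From mathcomp Require Import all_boot all_order all_algebra all_fingroup.
From mathcomp Require Import boolp reals.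
From mathcomp Require Import ring lra zify.
Set Implicit Arguments. Unset Strict Implicit. Unset Printing Implicit Defensive.
Import Order.TTheory GRing.Theory Num.Theory.
Local Open Scope ring_scope.

(** A nontrivial eigenvalue of modulus at least [d - eps] yields, by Cheeger's
    inequality, a nonempty set [S] of at most half of the vertices with at most
    [#|S| / q] boundary edges; for a negative eigenvalue and non-bipartite [B],
    [S] lives in the bipartite double cover of the lift.  If no component is
    small then [S] is large, and since (the double cover of) [B] is connected,
    [S] meets all fibres in about the same number of points.

    Recording membership in the two copies of each vertex turns [S] into a
    4-colouring [c] of the fibres such that every edge permutation respects the
    colours up to swapping the copies, with at most [t = k %/ L] errors, where
    some colour class has [k <= n / 2] points in some fibre.  Let [M v] be the
    number of colourings of the fibre over [v] with the same class sizes as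
    [c v].  A uniform permutation from [u] to [v] respects the colours with
    probability at most [Ball / sqrt (M u * M v)], a random half-loop
    permutation at [u] with probability at most [poly(n) * Ball / sqrt (M u)],
    where [Ball] bounds the volume of a Hamming ball of radius [t].  So [c] is
    respected with probability at most
    [poly(n) * Ball ^ #|E| * \prod_v M v ^ (- d / 2)].  As [d >= 3], summing
    over all [c] costs one factor [\prod_v M v] up to a polynomial and leaves
    [poly(n) * Ball ^ #|E| / sqrt 'C(n, k)].  For [L] large this is at most
    [poly(n) * 'C(n, k) ^ (- 1 / 4)], which beats any power of [n] as soon as
    [k] exceeds a suitable constant. *)

(** * Orthogonal eigenvectors of symmetric matrices *)

(** The update moves one copy of the eigenvalue [k] of [h] and leaves the others alone. Both sides
    come from the determinant of the bordered matrix [B], computed once by a Schur complement and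
    once by clearing its lower left block with [HP]. *)
Lemma char_poly_rank1_update (F : fieldType) (n : nat) (A : 'M[F]_n)
    (h : 'rV[F]_n) (k m : F) : h *m A = k *: h ->
  ('X - k%:P) * char_poly (A + m *: (h^T *m h)) =
  ('X - (k + m * (h *m h^T) 0 0)%:P) * char_poly A.
Proof.
move=> hA.
pose P := char_poly_mx A.
pose H := map_mx polyC h.
have HP : H *m P = ('X - k%:P) *: H.
  rewrite /P /char_poly_mx mulmxBr -map_mxM hA mul_mx_scalar scalerBl; congr (_ - _).
  by rewrite map_mxZ.
have PU : char_poly_mx (A + m *: (h^T *m h)) = P - m%:P *: (H^T *m H).
  rewrite /char_poly_mx /P map_mxD opprD addrA; congr (_ - _).
  apply/matrixP=> i j; rewrite !mxE /= polyCM rmorph_sum; congr (_ * _).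
  by apply: eq_bigr => l _; rewrite !mxE rmorphM.
pose B := block_mx P (m%:P *: H^T) H 1%:M.
have detB : \det B = char_poly (A + m *: (h^T *m h)).
  have -> : B = block_mx 1%:M (m%:P *: H^T) 0 1%:M *m
                block_mx (P - m%:P *: (H^T *m H)) 0 H 1%:M.
    rewrite mulmx_block !mul1mx !mul0mx !mulmx1 !add0r -scalemxAl subrK.
    by congr block_mx.
  by rewrite det_mulmx det_ublock det_lblock !det1 !mul1r mulr1 -PU.
have BE : block_mx 1%:M 0 (- H) ('X - k%:P)%:M *m B =
    block_mx P (m%:P *: H^T) 0 (('X - k%:P)%:M - m%:P *: (H *m H^T)).
  rewrite mulmx_block !mul1mx !mul0mx !addr0 !mulmx1 !mulNmx HP mul_scalar_mx.
  by rewrite addNr -scalemxAr addrC.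
have := congr1 determinant BE.
rewrite det_mulmx det_lblock det_ublock det1 mul1r detB !det_mx11.
rewrite -[\det P]/(char_poly A) [('X - k%:P)%:M 0 0]mxE eqxx mulr1n => ->.
rewrite mulrC; congr (_ * _).
rewrite !mxE eqxx /= !mulr1n polyCD opprD addrA; congr (_ - _).
rewrite polyCM rmorph_sum /=; congr (_ * _).
by apply: eq_bigr => l _; rewrite polyCM !mxE.
Qed.

(** Eigenvectors for distinct eigenvalues of a symmetric matrix are orthogonal, which settles the
    case where [a] or [b] differs from [k]. If both equal [k], adding [h^T *m h] moves only one copy
    of [k], and an eigenvector of the sum for the other copy is orthogonal to [h]. *)
Lemma orthogonal_eigenvector (R : realFieldType) (n : nat) (A : 'M[R]_n)
    (h : 'rV[R]_n) (k a b : R) :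
  A^T = A -> h *m A = k *: h -> h != 0 ->
  (('X - a%:P) * ('X - b%:P) %| char_poly A)%R ->
  exists (m : R) (f : 'rV[R]_n),
    [/\ m = a \/ m = b, f != 0, f *m A = m *: f & f *m h^T = 0].
Proof.
move=> symA hA h0 dvd.
have AhT : A *m h^T = k *: h^T by rewrite -[A in LHS]symA -trmx_mul hA linearZ.
have orth m (f : 'rV[R]_n) : m != k -> f *m A = m *: f -> f *m h^T = 0.
  move=> mk fA; have : m *: (f *m h^T) = k *: (f *m h^T).
    by rewrite scalemxAl -fA -mulmxA AhT scalemxAr.
  move/eqP; rewrite -subr_eq0 -scalerBl scaler_eq0 subr_eq0 (negPf mk).
  by move/eqP.
have eig m : root (char_poly A) m -> exists2 f : 'rV[R]_n, f *m A = m *: f & f != 0.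
  by rewrite -eigenvalue_root_char => /eigenvalueP.
have dva : root (char_poly A) a.
  by rewrite -dvdp_XsubCl; apply: dvdp_trans dvd; apply: dvdp_mulr.
have dvb : root (char_poly A) b.
  by rewrite -dvdp_XsubCl; apply: dvdp_trans dvd; apply: dvdp_mull.
have [ak|ak] := eqVneq a k; last first.
  have [f fA f0] := eig _ dva; exists a, f; split=> //; [by left|exact: orth fA].
have [bk|bk] := eqVneq b k; last first.
  have [f fA f0] := eig _ dvb; exists b, f; split=> //; [by right|exact: orth fA].
subst a b.
have hh : (h *m h^T) 0 0 != 0.
  rewrite mxE; apply: contra h0 => /eqP s0.
  apply/eqP/rowP => i; rewrite mxE.
  have H j : true -> 0 <= h 0 j * h^T j 0 by rewrite !mxE -expr2 sqr_ge0.
  have : h 0 i * h^T i 0 = 0 by apply: (psumr_eq0P H s0).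
  by rewrite !mxE => /eqP; rewrite -expr2 sqrf_eq0 => /eqP.
have := char_poly_rank1_update 1 hA.
set A' := A + _ => E.
have rA' : root (char_poly A') k.
  have Xk0 : 'X - k%:P != 0 by rewrite polyXsubC_eq0.
  rewrite -dvdp_XsubCl -(dvdp_mul2l _ _ Xk0) E; exact: dvdp_trans dvd (dvdp_mull _ (dvdpp _)).
rewrite -eigenvalue_root_char in rA'; case/eigenvalueP: rA' => f fA' f0.
(* Pairing [fA'] with [h^T] leaves [(f h^T) (h h^T) = 0]. *)
have fh : f *m h^T = 0.
  have : f *m A' *m h^T = k *: (f *m h^T) by rewrite fA' scalemxAl.
  rewrite /A' scale1r mulmxDr mulmxDl -!mulmxA AhT -!scalemxAr -[RHS]addr0.
  move/addrI; rewrite mulmxA [h *m h^T]mx11_scalar mul_mx_scalar => /eqP.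
  by rewrite scaler_eq0 (negPf hh) => /eqP.
exists k, f; split=> //; first by left.
by rewrite -fA' /A' scale1r mulmxDr mulmxA fh mul0mx addr0.
Qed.

(** * Cheeger's inequality *)

Section Cheeger.
Variables (R : realFieldType) (W F : finType) (tl hd : F -> W) (inv : F -> F).
Hypotheses (invK : involutive inv) (hd_inv : forall e, hd e = tl (inv e)).

Definition edge_boundary (S : {set W}) : {set F} :=
  [set e | (tl e \in S) && (hd e \notin S)].

Lemma tl_inv e : tl e = hd (inv e).
Proof. by rewrite hd_inv invK. Qed.

Lemma card_edge_boundaryC (S : {set W}) :
  #|[set e | (tl e \notin S) && (hd e \in S)]| = #|edge_boundary S|.
Proof.
rewrite -(card_imset _ (inv_inj invK)); apply: eq_card => e.
apply/imsetP/idP => [[e' + ->]|].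
  by rewrite !inE -hd_inv -tl_inv andbC.
rewrite inE => H; exists (inv e); rewrite ?invK //.
by rewrite inE -hd_inv -tl_inv andbC.
Qed.

Lemma sum_hd (h : W -> R) : \sum_e h (hd e) = \sum_e h (tl e).
Proof.
rewrite (reindex_inj (inv_inj invK)) /=.
by apply: eq_bigr => e _; rewrite -tl_inv.
Qed.

Lemma sum_tl d (h : W -> R) : gregular tl d ->
  \sum_e h (tl e) = d%:R * \sum_x h x.
Proof.
move=> reg; rewrite (partition_big tl predT) //= mulr_sumr.
apply: eq_bigr => x _.
rewrite (eq_bigr (fun=> h x)); last by move=> e /eqP ->.
by rewrite sumr_const -(reg x) /gdeg mulr_natl cardsE.
Qed.

Lemma sum_boundary_indicator (S : {set W}) :
  \sum_e `|(tl e \in S)%:R - (hd e \in S)%:R : R| = 2 * #|edge_boundary S|%:R.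
Proof.
rewrite mulr2n mulrDl mul1r -{2}card_edge_boundaryC -!sum1_card !natr_sum.
rewrite [in RHS]big_mkcond [X in _ = _ + X]big_mkcond -big_split /=.
apply: eq_bigr => e _; rewrite !inE.
by case: (tl e \in S); case: (hd e \in S) => /=;
  rewrite ?subrr ?subr0 ?sub0r ?normrN ?normr0 ?normr1 ?addr0 ?add0r.
Qed.

(* Coarea inequality, by peeling off the lowest level set of [h]. *)
Lemma isoperimetric_sum (dl : R) (h : W -> R) :
  (forall x, 0 <= h x) ->
  (forall S : {set W}, S \subset [set x | 0 < h x] ->
     dl * #|S|%:R <= #|edge_boundary S|%:R) ->
  2 * dl * \sum_x h x <= \sum_e `|h (tl e) - h (hd e)|.
Proof.
have [N] := ubnP #|[set x | 0 < h x]|.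
elim: N h => // N IH h leN h_ge0 iso.
set S := [set x | 0 < h x] in leN iso *.
have [S0|[x0 x0S]] := set_0Vmem S.
  have z x : h x = 0.
    apply/eqP; move/setP/(_ x): S0; rewrite !inE lt_def h_ge0 andbT.
    by move/negbT; rewrite negbK.
  rewrite big1 ?mulr0 ?sumr_ge0 //.
pose x1 := [arg min_(x < x0 in S) h x]%O.
have [x1S x1min] : x1 \in S /\ forall y, y \in S -> h x1 <= h y.
  by rewrite /x1; case: arg_minP.
pose m := h x1.
have m_gt0 : 0 < m by move: x1S; rewrite inE.
pose g x := h x - m * (x \in S)%:R.
have hS x : x \notin S -> h x = 0.
  by rewrite inE lt_def h_ge0 andbT negbK => /eqP.
have g_ge0 x : 0 <= g x.
  rewrite /g; case: (boolP (x \in S)) => xS; rewrite ?mulr1 ?mulr0 ?subr0 //.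
  by rewrite subr_ge0 x1min.
have gsub : [set x | 0 < g x] \subset S :\ x1.
  apply/subsetP => x; rewrite !inE /g; case: (boolP (x \in S)) => xS.
    rewrite mulr1 subr_gt0 => mx; rewrite (lt_trans m_gt0 mx) andbT.
    by apply: contraTneq mx => ->; rewrite ltxx.
  by rewrite mulr0 subr0 hS // ltxx.
have leg : (#|[set x | 0 < g x]%R| < N)%N.
  apply: leq_ltn_trans (subset_leq_card gsub) _.
  by move: leN; rewrite (cardsD1 x1 S) x1S.
have /IH-/(_ leg) IHg : forall x, 0 <= g x by [].
have {IHg} := IHg (fun T sT => iso T (subset_trans (subset_trans sT gsub) (subsetDl _ _))).
have -> : \sum_x h x = \sum_x g x + m * #|S|%:R.
  rewrite -sum1_card natr_sum mulr_sumr [X in _ + X]big_mkcond -big_split /=.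
  apply: eq_bigr => x _; rewrite /g.
  by case: (x \in S); rewrite ?mulr1 ?mulr0 ?subrK ?subr0 ?addr0.
(* [h] is at least [m] on [S] and zero off [S], so only edges crossing the boundary of [S] feel the
   subtraction, each losing exactly [m]. *)
have -> : \sum_e `|h (tl e) - h (hd e)| =
    \sum_e `|g (tl e) - g (hd e)| + m * (2 * #|edge_boundary S|%:R).
  rewrite -sum_boundary_indicator mulr_sumr -big_split /=.
  apply: eq_bigr => e _.
  have := g_ge0 (tl e); have := g_ge0 (hd e); have := @hS (tl e); have := @hS (hd e).
  rewrite /g.
  case: (tl e \in S); case: (hd e \in S) => /= A B C D;
    rewrite ?subrr ?subr0 ?sub0r ?mulr1 ?mulr0 ?normrN ?normr1 ?normr0 ?mulr1 ?mulr0 ?addr0 ?subr0 //.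
  - by congr `|_|; ring.
  - rewrite A // !subr0 ger0_norm; last by apply: le_trans (ltW m_gt0) _; move: D; lra.
    by rewrite ger0_norm; move: D; lra.
  - rewrite B // !sub0r !normrN ger0_norm; last by apply: le_trans (ltW m_gt0) _; move: C; lra.
    by rewrite ger0_norm; move: C; lra.
have := iso S (subxx _).
set s := \sum_x g x; set u := \sum_e _; set k := #|S|%:R; set b := #|_|%:R.
move=> H1 H2; have : m * (dl * k) <= m * b by rewrite ler_pM2l.
rewrite mulrDr; lra.
Qed.

(** The coarea inequality for the square of the positive part [g] of [f] is played against the
    energy of [g]. A weighted AM-GM inequality replaces Cauchy-Schwarz, so no square root has to
    exist in [R]. *)
Lemma cheeger_positive_part (d : nat) (dl mu : R) (f : W -> R) :
  gregular tl d -> (0 < d)%N -> 0 < dl -> d%:R - dl ^+ 2 / (4 * d%:R) <= mu ->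
  (forall x, \sum_(e | tl e == x) f (hd e) = mu * f x) ->
  (exists x, 0 < f x) ->
  exists S : {set W}, [/\ S != set0, S \subset [set x | 0 < f x] &
    #|edge_boundary S|%:R <= dl * #|S|%:R].
Proof.
move=> reg d_gt0 dl_gt0 mu_ge fE [x0 fx0].
apply: contrapT => noS.
pose g x := Num.max (f x) 0.
have g_ge0 x : 0 <= g x by rewrite /g le_max lexx orbT.
have fg x : f x <= g x by rewrite /g le_max lexx.
pose G := \sum_x g x ^+ 2.
have G_gt0 : 0 < G.
  rewrite /G (bigD1 x0) //= ltr_wpDr ?sumr_ge0 // => [x _|]; first exact: sqr_ge0.
  by rewrite exprn_gt0 // /g lt_max fx0.
have gpos : [set x | 0 < g x ^+ 2] = [set x | 0 < f x].
  apply/setP => x; rewrite !inE lt_def sqr_ge0 andbT sqrf_eq0.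
  by rewrite /g; case: (leP (f x) 0) => [_|/gt_eqF ->]; rewrite ?eqxx.
have iso : 2 * dl * G <= \sum_e `|g (tl e) ^+ 2 - g (hd e) ^+ 2|.
  apply: (@isoperimetric_sum dl (fun x => g x ^+ 2)) => [x|S].
    exact: sqr_ge0.
  rewrite gpos => sS; have [->|Sn0] := eqVneq S set0.
    by rewrite cards0 mulr0 ler0n.
  rewrite leNgt; apply/negP => lt; apply: noS; exists S; split=> //; exact: ltW.
have dR : 0 < d%:R :> R by rewrite ltr0n.
(* Where [f] is positive the eigenvalue equation applies, and [f <= g] at the neighbours; elsewhere
   both sides vanish. *)
have cross : mu * G <= \sum_e g (tl e) * g (hd e).
  rewrite (partition_big tl predT) //= /G mulr_sumr; apply: ler_sum => x _.
  have -> : \sum_(e | tl e == x) g (tl e) * g (hd e) =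
            g x * \sum_(e | tl e == x) g (hd e).
    by rewrite mulr_sumr; apply: eq_bigr => e /eqP ->.
  have -> : mu * g x ^+ 2 = g x * (mu * f x).
    rewrite /g; case: (leP (f x) 0) => _; ring.
  by rewrite -fE ler_wpM2l // ler_sum.
pose th := dl / (2 * d%:R).
have th_gt0 : 0 < th by rewrite divr_gt0 // mulr_gt0.
have energy : \sum_e (g (tl e) - g (hd e)) ^+ 2 =
    2 * d%:R * G - 2 * \sum_e g (tl e) * g (hd e).
  have -> : 2 * d%:R * G = \sum_e (g (tl e) ^+ 2 + g (hd e) ^+ 2).
    rewrite big_split /= (sum_hd (fun x => g x ^+ 2)).
    rewrite (sum_tl (fun x => g x ^+ 2) reg) -/G.
    by ring.
  rewrite mulr_sumr -sumrB; apply: eq_bigr => e _; ring.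
have plus : \sum_e (g (tl e) + g (hd e)) ^+ 2 <= 4 * d%:R * G.
  have -> : 4 * d%:R * G = \sum_e 2 * (g (tl e) ^+ 2 + g (hd e) ^+ 2).
    rewrite -mulr_sumr big_split /= (sum_hd (fun x => g x ^+ 2)).
    rewrite (sum_tl (fun x => g x ^+ 2) reg) -/G.
    by ring.
  apply: ler_sum => e _; have := sqr_ge0 (g (tl e) - g (hd e)); nra.
(* AM-GM: [|a^2 - b^2| <= (a - b)^2 / (2 th) + th (a + b)^2 / 2] *)
have amgm : \sum_e `|g (tl e) ^+ 2 - g (hd e) ^+ 2| * (2 * th) <=
   \sum_e ((g (tl e) - g (hd e)) ^+ 2 + th ^+ 2 * (g (tl e) + g (hd e)) ^+ 2).
  apply: ler_sum => e _.
  rewrite subr_sqr normrM (ger0_norm (addr_ge0 (g_ge0 (tl e)) (g_ge0 (hd e)))).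
  rewrite -[(_ - _) ^+ 2](real_normK (num_real _)).
  set a := `|_|; set b := g _ + g _.
  have := sqr_ge0 (a - th * b); nra.
rewrite -mulr_suml big_split /= -mulr_sumr energy in amgm.
set X := \sum_e `|_| in iso amgm; set Y := \sum_e _ * _ in amgm cross.
set Z := \sum_e _ in plus amgm.
have dth : dl = 2 * d%:R * th by rewrite /th; field; rewrite gt_eqF.
(* Since [dl = 2 * d * th], the estimates combine to [8 * d * th ^ 2 * G <= 6 * d * th ^ 2 * G],
   which is absurd. *)
have h1 : (2 * dl * G) * (2 * th) <= X * (2 * th) 
  by apply: ler_wpM2r iso; apply: mulr_ge0 => //; apply: ltW.
have h2 : th ^+ 2 * Z <= th ^+ 2 * (4 * d%:R * G) 
  by apply: ler_wpM2l plus; apply: sqr_ge0.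
have h3 : (d%:R - mu) * G <= d%:R * th ^+ 2 * G.
  rewrite ler_pM2r //.
  suff <- : dl ^+ 2 / (4 * d%:R) = d%:R * th ^+ 2 by move: mu_ge; lra.
  by rewrite /th; field; rewrite gt_eqF.
have h4 : 0 < d%:R * th ^+ 2 * G 
  by apply: mulr_gt0 => //; apply: mulr_gt0 => //; apply: exprn_gt0.
move: h1; rewrite dth; nra.
Qed.

(** Passing to [- f] if necessary makes the positive support at most half of the vertices; it is
    nonempty because [f] is nonzero with sum zero. *)
Lemma cheeger (d : nat) (dl mu : R) (f : W -> R) :
  gregular tl d -> (0 < d)%N -> 0 < dl -> d%:R - dl ^+ 2 / (4 * d%:R) <= mu ->
  (forall x, \sum_(e | tl e == x) f (hd e) = mu * f x) ->
  (exists x, f x != 0) -> \sum_x f x = 0 ->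
  exists S : {set W}, [/\ S != set0, (2 * #|S| <= #|W|)%N &
    #|edge_boundary S|%:R <= dl * #|S|%:R].
Proof.
move=> reg d_gt0 dl_gt0 mu_ge.
wlog: f / (2 * #|[set x | 0 < f x]%R| <= #|W|)%N => [hw|le] fE f0 sf.
  have [le|gt] := leqP (2 * #|[set x | 0 < f x]%R|) #|W|; first exact: (hw f).
  apply: (hw (fun x => - f x)).
  - have : [set x | 0 < - f x] \subset ~: [set x | 0 < f x].
      by apply/subsetP => x; rewrite !inE oppr_gt0 -leNgt => /ltW.
    move/subset_leq_card; have := cardsC [set x | 0 < f x]; lia.
  - by move=> x; rewrite sumrN fE mulrN.
  - by case: f0 => x; rewrite -oppr_eq0; exists x.
  - by rewrite sumrN sf oppr0.
have [S [Sn sS bS]] : exists S : {set W}, [/\ S != set0, S \subset [set x | 0 < f x] &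
    #|edge_boundary S|%:R <= dl * #|S|%:R].
  apply: (cheeger_positive_part reg d_gt0 dl_gt0 mu_ge fE).
  apply: contrapT => nex; case: f0 => x; apply/negP; rewrite negbK.
  have fle y : 0 <= - f y.
    by rewrite oppr_ge0 leNgt; apply/negP => fy; apply: nex; exists y.
  have /psumr_eq0P : \sum_y - f y = 0 by rewrite sumrN sf oppr0.
  by move=> /(_ (fun i _ => fle i) x isT) /eqP; rewrite oppr_eq0.
exists S; split=> //; have := subset_leq_card sS; lia.
Qed.
End Cheeger.

(** * Spectral gap and expansion *)

Section EigenFunctions.
Variables (R : realType) (W F : finType) (tl hd : F -> W) (inv : F -> F).
Hypotheses (invK : involutive inv) (hd_inv : forall e, hd e = tl (inv e)).

Definition adjop (f : W -> R) (x : W) : R := \sum_(e | tl e == x) f (hd e).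

Lemma gadjmx_sym : (gadjmx tl hd R)^T = gadjmx tl hd R.
Proof.
apply/matrixP => i j; rewrite !mxE; congr (_%:R).
rewrite -(card_imset _ (inv_inj invK)); apply: eq_card => e.
apply/imsetP/idP => [[e' + ->]|]; rewrite !inE.
  by rewrite !hd_inv invK andbC.
by move=> H; exists (inv e); rewrite ?invK // inE !hd_inv invK -hd_inv andbC.
Qed.

(** A row vector is paired with columns of the matrix, that is, with incoming edges; [inv] turns
    these into outgoing ones. *)
Lemma row_mul_gadjmx (f : W -> R) :
  (\row_i f (enum_val i)) *m gadjmx tl hd R = \row_i adjop f (enum_val i).
Proof.
apply/rowP => j; rewrite !mxE; set y := enum_val j.
transitivity (\sum_(x : W) f x * #|[set e | (tl e == x) && (hd e == y)]|%:R).
  rewrite [RHS](reindex (fun i : 'I_#|W| => enum_val i)) /=; last exact/onW_bij/enum_val_bij.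
  by apply: eq_bigr => i _; rewrite !mxE.
rewrite /adjop (reindex_inj (inv_inj invK)) /=.
rewrite (eq_bigl (fun e => hd e == y)) => [|e]; last by rewrite hd_inv.
rewrite (partition_big tl predT) //=; apply: eq_bigr => x _.
rewrite (eq_bigr (fun=> f x)) => [|e /andP[_ /eqP <-]]; last by rewrite hd_inv invK.
rewrite sumr_const mulr_natr; congr (_ *+ _); apply: eq_card => e.
by rewrite !inE andbC.
Qed.

Lemma row_of_fun (v : 'rV[R]_#|W|) : v = \row_i v 0 (enum_rank (enum_val i)).
Proof. by apply/rowP => i; rewrite mxE enum_valK. Qed.

Lemma row_fun_inj (f g : W -> R) :
  \row_(i < #|W|) f (enum_val i) = \row_i g (enum_val i) -> f =1 g.
Proof. by move=> /rowP e x; have := e (enum_rank x); rewrite !mxE enum_rankK. Qed.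

Lemma eigenfun_of_row (v : 'rV[R]_#|W|) (m : R) : v != 0 ->
  v *m gadjmx tl hd R = m *: v ->
  let f x := v 0 (enum_rank x) in (exists x, f x != 0) /\ forall x, adjop f x = m * f x.
Proof.
move=> v0 vA f; split.
  have /rV0Pn[i vi] := v0; exists (enum_val i); by rewrite /f enum_valK.
apply: row_fun_inj; rewrite -row_mul_gadjmx -row_of_fun vA.
by apply/rowP => i; rewrite !mxE /f enum_valK.
Qed.

Lemma eigenfun_root (m : R) : root (char_poly (gadjmx tl hd R)) m ->
  exists f : W -> R, (exists x, f x != 0) /\ forall x, adjop f x = m * f x.
Proof.
rewrite -eigenvalue_root_char => /eigenvalueP[v vA v0].
by exists (fun x => v 0 (enum_rank x)); apply: eigenfun_of_row.
Qed.

Lemma dvdp_prod_XsubC2 (s : seq R) i j : (i < j < size s)%N ->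
  (('X - (s`_i)%:P) * ('X - (s`_j)%:P) %| \prod_(x <- s) ('X - x%:P))%R.
Proof.
move=> /andP[ij js]; have is_ := ltn_trans ij js.
rewrite (big_nth 0) big_mkord (bigD1 (Ordinal is_)) //= (bigD1 (Ordinal js)) /=.
  by rewrite mulrA dvdp_mulr.
by rewrite -val_eqE /= gtn_eqF.
Qed.

(** Indices rather than values are given, so that a repeated eigenvalue counts twice; whichever of
    the two is obtained, sortedness bounds it in the applications. *)
Lemma orthogonal_eigenfun (h : W -> R) (k : R) (s : seq R) (i j : nat) :
  (exists x, h x != 0) -> (forall x, adjop h x = k * h x) ->
  char_poly (gadjmx tl hd R) = \prod_(x <- s) ('X - x%:P) -> (i < j < size s)%N ->
  exists (m : R) (f : W -> R), [/\ m = s`_i \/ m = s`_j, exists x, f x != 0,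
    forall x, adjop f x = m * f x & \sum_x f x * h x = 0].
Proof.
move=> [x hx] hA cs ij.
pose H : 'rV[R]_#|W| := \row_i h (enum_val i).
have HA : H *m gadjmx tl hd R = k *: H.
  by rewrite row_mul_gadjmx; apply/rowP => l; rewrite !mxE.
have H0 : H != 0 by apply/rV0Pn; exists (enum_rank x); rewrite mxE enum_rankK.
have dv := dvdp_prod_XsubC2 ij; rewrite -cs in dv.
have [m [f [mE f0 fA fH]]] := orthogonal_eigenvector gadjmx_sym HA H0 dv.
have [g0 gA] := eigenfun_of_row f0 fA.
exists m, (fun x => f 0 (enum_rank x)); split=> //.
move/matrixP/(_ 0 0): fH; rewrite !mxE; apply: etrans.
rewrite (reindex (fun i : 'I_#|W| => enum_val i)) /=; last exact/onW_bij/enum_val_bij.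
by apply: eq_bigr => l _; rewrite !mxE enum_valK.
Qed.

Lemma adjop_cst d : gregular tl d -> forall x, adjop (fun=> 1) x = d%:R * 1.
Proof. by move=> reg x; rewrite /adjop sumr_const mulr1 -(reg x) /gdeg cardsE. Qed.

(* Bipartite double cover. *)
Definition dtl (p : F * bool) : W * bool := (tl p.1, p.2).
Definition dhd (p : F * bool) : W * bool := (hd p.1, ~~ p.2).
Definition dinv (p : F * bool) : F * bool := (inv p.1, ~~ p.2).

Lemma dinvK : involutive dinv.
Proof. by case=> e b; rewrite /dinv /= invK negbK. Qed.

Lemma dhd_inv p : dhd p = dtl (dinv p).
Proof. by rewrite /dhd /dtl hd_inv. Qed.

Lemma double_regular d : gregular tl d -> gregular dtl d.
Proof.
move=> reg [x b]; rewrite -(reg x) /gdeg.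
rewrite -(card_imset [set e | tl e == x] (f := fun e => (e, b))); last by move=> ? ? [].
apply: eq_card => -[e b']; rewrite !inE; apply/idP/imsetP.
  by rewrite /dtl /= => /eqP[<- <-]; exists e; rewrite ?inE.
by case=> e'; rewrite inE => /eqP <- [-> ->]; rewrite /dtl /=.
Qed.

Lemma cheeger_nat (d q : nat) (mu : R) (f : W -> R) :
  gregular tl d -> (0 < d)%N -> (0 < q)%N ->
  d%:R - (q%:R^-1) ^+ 2 / (4 * d%:R) <= mu ->
  (forall x, adjop f x = mu * f x) ->
  (exists x, f x != 0) -> \sum_x f x = 0 ->
  exists S : {set W}, [/\ S != set0, (2 * #|S| <= #|W|)%N &
    (q * #|edge_boundary tl hd S| <= #|S|)%N].
Proof.
move=> reg d0 q0 mu_ge fE f0 sf.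
have qR : 0 < q%:R :> R by rewrite ltr0n.
have qV : 0 < q%:R^-1 :> R by rewrite invr_gt0.
have [S [S0 S2 Sb]] := cheeger invK hd_inv reg d0 qV mu_ge fE f0 sf.
exists S; split=> //; move: Sb; rewrite mulrC ler_pdivlMr // mulrC.
by rewrite -natrM ler_nat.
Qed.
End EigenFunctions.

Section SpectralGap.
Variables (R : realType) (W F : finType) (tl hd : F -> W) (inv : F -> F) (d q : nat).
Hypotheses (invK : involutive inv) (hd_inv : forall e, hd e = tl (inv e)).
Hypotheses (reg : gregular tl d) (d_gt0 : (0 < d)%N) (q_gt0 : (0 < q)%N).

Let eps : R := (q%:R^-1) ^+ 2 / (4 * d%:R).

Let eps_lt : eps < d%:R.
Proof.
have d1 : 1 <= d%:R :> R by rewrite ler1n.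
have q1 : q%:R^-1 <= 1 :> R by rewrite invf_le1 ?ler1n ?ltr0n.
have q0 : 0 <= q%:R^-1 :> R by rewrite invr_ge0.
by rewrite /eps ltr_pdivrMr; nra.
Qed.

(** [#|W|] is half the order of the double cover, so this is what Cheeger's inequality yields there.
    The bipartite case is brought to the same form, with both copies of a vertex in the set or
    neither. *)
Definition low_expansion (S : {set W * bool}) : Prop :=
  [/\ S != set0, (#|S| <= #|W|)%N &
    (q * #|edge_boundary (dtl tl) (dhd hd) S| <= #|S|)%N].

Lemma eigenseq_nth_ge (s : seq R) (A : 'M[R]_#|W|) i j : is_eigenseq A s ->
  (i <= j < size s)%N -> s`_j <= s`_i.
Proof.
move=> [srt _] /andP[ij js].
by apply: (sorted_leq_nth (leT := fun x y : R => y <= x)) => //;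
  rewrite ?inE ?(leq_ltn_trans ij) // => y x z h1 h2; apply: le_trans h1.
Qed.

(* On the double cover, [(f, sg m * f)] has eigenvalue [`|m|]. *)
Lemma nonbipartite_low_expansion (s : seq R) i :
  is_eigenseq (gadjmx tl hd R) s -> (0 < i < size s)%N -> d%:R - eps <= `|s`_i| ->
  exists S, low_expansion S.
Proof.
move=> es /andP[i0 iS] large.
(* For a negative eigenvalue any eigenfunction will do, since [(f, - f)] has sum zero. For a
   nonnegative one, the indices [0] and [i] both carry values at least the [i]-th. *)
have [m [f [f0 fA m_ge sf]]] : exists (m : R) (f : W -> R), [/\ exists x, f x != 0,
    forall x, adjop tl hd f x = m * f x, d%:R - eps <= `|m| & 0 < m -> \sum_x f x = 0].
  have [si_lt0|si_ge0] := ltP s`_i 0.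
    have rt : root (char_poly (gadjmx tl hd R)) s`_i.
      by case: es => _ ->; rewrite root_prod_XsubC mem_nth.
    have [f [f0 fA]] := eigenfun_root invK hd_inv rt.
    by exists s`_i, f; split=> //; rewrite ltNge (ltW si_lt0).
  rewrite ger0_norm // in large.
  have [] := @orthogonal_eigenfun R W F tl hd inv invK hd_inv (fun=> 1) d%:R s 0%N i.
  - have : (0 < #|W|)%N.
      have := congr1 (fun p : {poly R} => size p) es.2.
      by rewrite size_char_poly size_prod_XsubC => -[->]; apply: leq_ltn_trans iS.
    by case/card_gt0P => x _; exists x; rewrite oner_neq0.
  - exact: adjop_cst.
  - exact: es.2.
  - by rewrite i0.
  move=> m [f [mE f0 fA sf]]; exists m, f; split=> //.
    apply: le_trans (ler_norm _).
    by case: mE => -> //; apply: le_trans large _; apply: eigenseq_nth_ge es _.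
  by rewrite -[RHS]sf => _; apply: eq_bigr => x _; rewrite mulr1.
have m0 : m != 0 by apply: contraTneq m_ge => ->; rewrite normr0 -ltNge subr_gt0 eps_lt.
pose g (p : W * bool) := if p.2 then Num.sg m * f p.1 else f p.1.
have [] := @cheeger_nat R _ _ (dtl tl) (dhd hd) (dinv inv) (dinvK invK)
  (dhd_inv hd_inv) d q `|m| g.
- exact: double_regular.
- by [].
- by [].
- by [].
- move=> [x b]; rewrite /adjop.
  have -> : \sum_(p | dtl tl p == (x, b)) g (dhd hd p) =
            \sum_(e | tl e == x) g (hd e, ~~ b).
    rewrite -(pair_big_dep (fun e : F => tl e == x) (fun _ c => c == b)
       (fun e c => g (hd e, ~~ c))) /=.
      by apply: eq_bigr => e _; rewrite big_pred1_eq.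
  have := fA x; rewrite /adjop /g /= => fx.
  have mm : Num.sg m * m = `|m| by rewrite -normrEsg.
  have ss : Num.sg m * Num.sg m = 1 by rewrite -expr2 sqr_sg m0.
  case: b => /=; rewrite -?mulr_sumr fx.
    transitivity (Num.sg m * Num.sg m * (m * f x)); first by rewrite ss mul1r.
    by rewrite -mm; ring.
  by rewrite -mm; ring.
- by case: f0 => x fx; exists (x, false).
- rewrite -(pair_bigA _ (fun x b => g (x, b))) /=.
  rewrite (eq_bigr (fun x => (Num.sg m + 1) * f x)) => [|x _]; last first.
    by rewrite big_bool /g /= mulrDl mul1r.
  rewrite -mulr_sumr; move: m0; rewrite neq_lt => /orP[m0|m0].
    by rewrite ltr0_sg // addNr mul0r.
  by rewrite sf // mulr0.
move=> S [S0 S2 Sb]; exists S; split=> //.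
by move: S2; rewrite card_prod card_bool mulnC leq_pmul2r.
Qed.

(* Multiplying by the sign of the bipartition turns eigenvalue [-m] into [m]. *)
Lemma bipartite_low_expansion (s : seq R) i (col : W -> bool) :
  (forall e, col (tl e) != col (hd e)) ->
  is_eigenseq (gadjmx tl hd R) s -> (0 < i < size s)%N -> i != (size s).-1 ->
  d%:R - eps <= `|s`_i| ->
  exists S : {set W}, low_expansion (setX S [set: bool]).
Proof.
move=> bip es /andP[i0 iS] iN large.
have W0 : (0 < #|W|)%N.
  have := congr1 (fun p : {poly R} => size p) es.2.
  by rewrite size_char_poly size_prod_XsubC => -[->]; apply: leq_ltn_trans iS.
have [x0 _] := card_gt0P W0.
pose chi x : R := (-1) ^+ col x.
have chi_hd e : chi (hd e) = - chi (tl e).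
  by rewrite /chi; have := bip e; case: (col (tl e)); case: (col (hd e)) => //; rewrite ?opprK.
have [m [f [f0 fA m_ge sf]]] : exists (m : R) (f : W -> R), [/\ exists x, f x != 0,
    forall x, adjop tl hd f x = m * f x, d%:R - eps <= m & \sum_x f x = 0].
  have [si_lt0|si_ge0] := ltP s`_i 0.
    rewrite ltr0_norm // in large.
    (* The sign [chi], with eigenvalue [- d], takes the place of the constants. The last index is
       paired with [i] because both values are at most the [i]-th, and orthogonality to [chi] says
       that [f * chi] has sum zero. *)
    have [] := @orthogonal_eigenfun R W F tl hd inv invK hd_inv chi (- d%:R) s i (size s).-1.
    - by exists x0; rewrite signr_eq0.
    - move=> x; rewrite /adjop (eq_bigr (fun=> - chi x)) => [|e /eqP <-]; last exact: chi_hd.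
      by rewrite sumrN sumr_const -(reg x) /gdeg cardsE mulNr mulr_natl.
    - exact: es.2.
    - by move: iN iS; lia.
    move=> m [f [mE f0 fA sf]]; exists (- m), (fun x => f x * chi x); split.
    - by case: f0 => x fx; exists x; rewrite mulf_neq0 ?signr_eq0.
    - move=> x; have := fA x; rewrite /adjop => fx.
      rewrite (eq_bigr (fun e => - chi x * f (hd e))) => [|e /eqP <-]; last first.
        by rewrite chi_hd; ring.
      by rewrite -mulr_sumr fx; ring.
    - suff : m <= s`_i by lra.
      by case: mE => -> //; apply: eigenseq_nth_ge es _; lia.
    - by [].
  rewrite ger0_norm // in large.
  have [] := @orthogonal_eigenfun R W F tl hd inv invK hd_inv (fun=> 1) d%:R s 0%N i.
  - by exists x0; rewrite oner_neq0.
  - exact: adjop_cst.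
  - exact: es.2.
  - by rewrite i0.
  move=> m [f [mE f0 fA sf]]; exists m, f; split=> //.
    by case: mE => -> //; apply: le_trans large _; apply: eigenseq_nth_ge es _.
  by rewrite -[RHS]sf; apply: eq_bigr => x _; rewrite mulr1.
have [S [S0 S2 Sb]] := cheeger_nat invK hd_inv reg d_gt0 q_gt0 m_ge fA f0 sf.
exists S; split.
- by case/set0Pn: S0 => x xS; apply/set0Pn; exists (x, true); rewrite !inE xS.
- by rewrite cardsX cardsT card_bool; lia.
- rewrite cardsX cardsT card_bool.
  suff -> : #|edge_boundary (dtl tl) (dhd hd) (setX S [set: bool])| =
            (#|edge_boundary tl hd S| * 2)%N by lia.
  have <- : #|[set: bool]| = 2%N by rewrite cardsT card_bool.
  rewrite -cardsX; apply: eq_card => -[e b].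
  by rewrite !inE !andbT.
Qed.

End SpectralGap.

(** * Colourings with given class sizes *)

Lemma leq_card_bigcup (T I : finType) (P : {set I}) (F : I -> {set T}) :
  (#|\bigcup_(i in P) F i| <= \sum_(i in P) #|F i|)%N.
Proof.
elim/big_rec2: _ => [|i m A _ le]; first by rewrite cards0.
apply: leq_trans (leq_card_setU _ _) _; by rewrite leq_add2l.
Qed.

Section Colourings.
Local Open Scope nat_scope.
Variables (n : nat) (K : finType).
Implicit Types (c : {ffun 'I_n -> K}) (s : {perm 'I_n}).

(** Class sizes never exceed [n], so [inord] truncates nothing; with this codomain there are only
    [n.+1 ^ #|K|] profiles, a polynomial in [n]. *)
Definition profile (A : {set 'I_n}) c : {ffun K -> 'I_n.+1} :=
  [ffun k => inord #|[set i in A | c i == k]|].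

Lemma profileE A c k : profile A c k = #|[set i in A | c i == k]| :> nat.
Proof.
by rewrite ffunE inordK // ltnS -[X in _ <= X]card_ord max_card.
Qed.

Definition type_class c : {set {ffun 'I_n -> K}} :=
  [set c' | profile setT c' == profile setT c].

Definition recolour c s : {ffun 'I_n -> K} := [ffun i => c (s i)].

Lemma type_class_refl c : c \in type_class c.
Proof. by rewrite inE. Qed.

Lemma card_type_class_gt0 c : 0 < #|type_class c|.
Proof. by apply/card_gt0P; exists c; apply: type_class_refl. Qed.

Lemma recolour_type_class c s : recolour c s \in type_class c.
Proof.
rewrite inE; apply/eqP/ffunP => k; apply: val_inj; rewrite /= !profileE.
rewrite -(card_imset _ (@perm_inj _ s)); apply: eq_card => i.
apply/imsetP/idP => [[i' + ->]|]; first by rewrite !inE ffunE.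
by rewrite !inE /= => ci; exists (s^-1%g i); rewrite ?permKV // !inE ffunE permKV.
Qed.

Lemma type_classP c c' : reflect (exists s, c' = recolour c s) (c' \in type_class c).
Proof.
apply: (iffP idP) => [|[s ->]]; last exact: recolour_type_class.
rewrite inE => /eqP pp.
have /tuple_permP[s es] : perm_eq [tuple c' i | i < n] [tuple c i | i < n].
  apply/allP => k _ /=; rewrite !count_map.
  have cnt (f : {ffun 'I_n -> K}) : count (preim f (pred1 k)) (enum 'I_n) = profile setT f k.
    rewrite profileE cardE /(enum_mem (mem _)) size_filter enumT.
    by apply: eq_count => i; rewrite !inE.
  by apply/eqP; move: (cnt c') (cnt c); rewrite pp !enumT => h1 h2; exact: etrans h1 (esym h2).
exists s; apply/ffunP => i; rewrite ffunE.
have /(congr1 (fun t => tnth t i)) := val_inj es.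
by rewrite !tnth_mktuple.
Qed.

(** Orbit-stabiliser: the fibres of [recolour c] over the type class are translates of each
    other. *)
Lemma card_recolour_fiber c c' :
  #|[set s | recolour c s == c']| * #|type_class c| <= n`!.
Proof.
have [->|[s0]] := set_0Vmem [set s | recolour c s == c']; first by rewrite cards0.
rewrite inE => /eqP es0.
rewrite -(card_Sn n) -[X in _ <= X]sum1_card.
rewrite (partition_big (recolour c) (mem (type_class c))) /=; last first.
  by move=> s _; apply: recolour_type_class.
rewrite mulnC -sum_nat_const; apply: leq_sum => c'' /type_classP[s1 es1].
rewrite sum1_card.
pose r := (s1 * s0^-1)%g.
rewrite -(card_imset [set s | recolour c s == c'] (mulgI r)).
apply/subset_leq_card/subsetP => _ /imsetP[s + ->].
rewrite inE => /eqP es; rewrite -[_ \in _]/(recolour c (r * s)%g == c'').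
apply/eqP/ffunP => i.
have /ffunP/(_ (r i)) := es; rewrite -es0 es1 !ffunE permM => ->.
by rewrite /r permM permKV.
Qed.

Definition mismatch c c' : {set 'I_n} := [set i | c i != c' i].
Definition hamming_ball c t := [set c' | #|mismatch c' c| <= t].
Definition ball_bound t := 'C(n, t) * #|K| ^ t.

(** A colouring in the ball agrees with [c] off some [D] of size exactly [t] (the mismatch set,
    padded), hence is determined by [D] and its colours there. *)
Lemma card_hamming_ball c t : t <= n -> #|hamming_ball c t| <= ball_bound t.
Proof.
move=> tn.
pose U (D : {set 'I_n}) : {set {ffun 'I_n -> K}} := [set c' | mismatch c' c \subset D].
have sub : hamming_ball c t \subset \bigcup_(D in [set D : {set 'I_n} | #|D| == t]) U D.
  apply/subsetP => c'; rewrite inE => ct.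
  have [D mD cD] : exists2 D : {set 'I_n}, mismatch c' c \subset D & #|D| = t.
    set m := mismatch c' c in ct *.
    pose D := m :|: [set i in take (t - #|m|) (enum (~: m))].
    exists D; first exact: subsetUl.
    have mn : #|~: m| = n - #|m| by rewrite cardsCs setCK card_ord.
    have hsz : size (take (t - #|m|) (enum (~: m))) = t - #|m|.
      by rewrite size_takel // -cardE mn; lia.
    rewrite cardsU (_ : _ :&: _ = set0); last first.
      apply/setP => i; rewrite !inE; apply/negbTE/negP => /andP[im /mem_take].
      by rewrite mem_enum !inE im.
    have -> : #|[set i in take (t - #|m|) (enum (~: m))]| = t - #|m|.
      by rewrite cardsE -[RHS]hsz; apply/card_uniqP; rewrite take_uniq ?enum_uniq.
    by rewrite cards0; lia.
  by apply/bigcupP; exists D; rewrite inE ?cD.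
apply: leq_trans (subset_leq_card sub) _.
apply: leq_trans (leq_card_bigcup _ _) _.
rewrite /ball_bound -[X in 'C(X, _)]card_ord -card_draws -sum_nat_const.
apply: leq_sum => D; rewrite inE => /eqP <-.
pose f (c' : {ffun 'I_n -> K}) := [ffun x : {i | i \in D} => c' (val x)].
have finj : {in U D &, injective f}.
  move=> c1 c2; rewrite !inE => /subsetP s1 /subsetP s2 /ffunP e12.
  apply/ffunP => i; have [iD|iD] := boolP (i \in D).
    by have := e12 (Sub i iD); rewrite !ffunE SubK.
  have : i \notin mismatch c1 c by apply: contra iD => /s1.
  have : i \notin mismatch c2 c by apply: contra iD => /s2.
  by rewrite !inE !negbK => /eqP -> /eqP ->.
rewrite -(card_in_imset finj) -[X in _ ^ X]card_sig -card_ffun.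
exact: max_card.
Qed.

Lemma ball_bound_gt0 t : t <= n -> 0 < #|K| -> 0 < ball_bound t.
Proof. by move=> tn K0; rewrite muln_gt0 bin_gt0 tn expn_gt0 K0. Qed.

Definition matchings (a b : {ffun 'I_n -> K}) t : {set {perm 'I_n}} :=
  [set s | #|mismatch (recolour b s) a| <= t].

Lemma card_matchings a b t : t <= n ->
  #|matchings a b t| * #|type_class b| <= n`! * ball_bound t.
Proof.
move=> tn.
have -> : #|matchings a b t| =
    \sum_(c in hamming_ball a t) #|[set s | recolour b s == c]|.
  rewrite -sum1_card (partition_big (recolour b) (mem (hamming_ball a t))) /=.
    apply: eq_bigr => c; rewrite inE => ct; rewrite sum1_card; apply: eq_card => s.
    by rewrite [LHS]unfold_in [RHS]inE /= andb_idl // => /eqP es; rewrite inE es.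
  by move=> s; rewrite !inE.
rewrite big_distrl /=.
apply: (@leq_trans (\sum_(c in hamming_ball a t) n`!)).
  by apply: leq_sum => c _; apply: card_recolour_fiber.
by rewrite sum_nat_const mulnC leq_mul2l card_hamming_ball ?orbT.
Qed.

Section Involution.
Variable tau : K -> K.
Hypothesis tauK : involutive tau.
(** An edge of the double cover changes the sheet, so colours are compared along an edge only after
    applying [tau]. *)
Definition twist c : {ffun 'I_n -> K} := [ffun i => tau (c i)].

Lemma card_mismatch_swap a b s :
  #|mismatch (recolour b s) (twist a)| = #|mismatch (recolour a s^-1%g) (twist b)|.
Proof.
rewrite -(card_imset _ (@perm_inj _ s)); apply: eq_card => i.
apply/imsetP/idP => [[i' + ->]|].
  by rewrite !inE !ffunE permK; apply: contra => /eqP ->; rewrite tauK.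
rewrite !inE !ffunE => H; exists (s^-1%g i); rewrite ?permKV //.
by rewrite !inE !ffunE permKV; apply: contra H => /eqP ->; rewrite tauK.
Qed.

Lemma card_matchings_swap a b t :
  #|matchings (twist a) b t| = #|matchings (twist b) a t|.
Proof.
rewrite -(card_imset _ (@invg_inj _)); apply: eq_card => s.
apply/imsetP/idP => [[s' + ->]|].
  by rewrite !inE card_mismatch_swap.
by rewrite !inE => H; exists s^-1%g; rewrite ?invgK // inE card_mismatch_swap invgK.
Qed.

(** Inverting permutations exchanges [a] and [b], so either type class may divide the bound;
    multiplying the two bounds gives their geometric mean, squared. *)
Lemma card_matchings_sqr a b t : t <= n ->
  #|matchings (twist a) b t| ^ 2 * (#|type_class a| * #|type_class b|) <=
  (n`! * ball_bound t) ^ 2.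
Proof.
move=> tn; have h1 := card_matchings (twist a) b tn.
have := card_matchings (twist b) a tn; rewrite -card_matchings_swap => h2.
by rewrite mulnC -mulnn mulnACA -[X in _ <= X]mulnn leq_mul // mulnC.
Qed.


Lemma leq_sqr_sum (I : finType) (P : {set I}) (F : I -> nat) Y :
  (forall i, i \in P -> F i ^ 2 <= Y) -> (\sum_(i in P) F i) ^ 2 <= #|P| ^ 2 * Y.
Proof.
move=> le; rewrite -mulnn big_distrl /=.
have -> : #|P| ^ 2 * Y = \sum_(i in P) \sum_(j in P) Y.
  by rewrite !sum_nat_const -mulnn mulnA.
apply: leq_sum => i iP; rewrite big_distrr /=; apply: leq_sum => j jP.
by move: (le i iP) (le j jP); rewrite -!mulnn; nia.
Qed.

(** * Colourings almost equivariant under an involution with at most one fixed point *)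

Section FixedInvolution.
Variables (s : {perm 'I_n}) (t : nat).
Hypotheses (sK : involutive s) (fix1 : #|[set i | s i == i]| <= 1) (tn : t <= n).
Hypothesis n_gt0 : 0 < n.

(** One point from each 2-cycle of [s]; the complement holds the other points and the possible fixed
    point. *)
Let A : {set 'I_n} := [set i : 'I_n | i < s i].

Let A_s i : i \in A -> s i \notin A.
Proof. by rewrite !inE sK -leqNgt => /ltnW. Qed.

Let notA i : i \notin A -> s i \notin A -> s i = i.
Proof. by rewrite !inE sK -!leqNgt => h1 h2; apply/val_inj/anti_leq; rewrite h1 h2. Qed.

Let equivariant c := #|mismatch (recolour c s) (twist c)| <= t.

Let card_equivariant_A w :
  #|[set c | equivariant c & [forall (i | i \in A), c i == w i]]| <= #|K| * ball_bound t.
Proof.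
(* The colour of a fixed point is not constrained by [w], which costs the factor [#|K|]. The default
   in [i0] is harmless: without a fixed point, [z0] never takes its last branch. *)
pose i0 : 'I_n := odflt (Ordinal n_gt0) [pick i | s i == i].
have i0P i : s i = i -> i = i0.
  move=> si; rewrite /i0; case: pickP => [j /eqP sj|/(_ i)]; last by rewrite si eqxx.
  apply/eqP; apply: contraTT fix1 => ij; rewrite -ltnNge.
  by apply/card_gt1P; exists i, j; rewrite !inE si sj eqxx.
pose z0 k : {ffun 'I_n -> K} :=
  [ffun i => if i \in A then w i else if s i \in A then tau (w (s i)) else k].
apply: (@leq_trans #|\bigcup_(k in [set: K]) hamming_ball (z0 k) t|).
  apply/subset_leq_card/subsetP => c; rewrite inE => /andP[ct /forallP cw].
  apply/bigcupP; exists (c i0); rewrite ?inE //.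
  apply: leq_trans ct; rewrite -(card_imset _ (@perm_inj _ s)).
  apply/subset_leq_card/subsetP => _ /imsetP[i + ->].
  rewrite !inE !ffunE; case: ifPn => iA; first by have /implyP/(_ iA) -> := cw i.
  case: ifPn => siA; last by rewrite -(i0P i (notA iA siA)) eqxx.
  by have /implyP/(_ siA)/eqP <- := cw (s i); rewrite sK.
apply: leq_trans (leq_card_bigcup _ _) _.
rewrite -[#|K|]cardsT -sum_nat_const; apply: leq_sum => k _.
exact: card_hamming_ball.
Qed.

Let card_equivariant_NA w : 0 < #|K| ->
  #|[set c | equivariant c & [forall (i | i \notin A), c i == w i]]| <= #|K| * ball_bound t.
Proof.
move=> K_gt0.
pose z0 : {ffun 'I_n -> K} := [ffun i => if i \in A then tau (w (s i)) else w i].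
apply: (@leq_trans #|hamming_ball z0 t|); last first.
  by apply: leq_trans (card_hamming_ball _ tn) _; rewrite leq_pmull.
apply/subset_leq_card/subsetP => c; rewrite !inE => /andP[ct /forallP cw].
apply: leq_trans ct; rewrite -(card_imset _ (@perm_inj _ s)).
apply/subset_leq_card/subsetP => _ /imsetP[i + ->].
rewrite !inE !ffunE; case: ifPn => iA; last by have /implyP/(_ iA) -> := cw i.
by have /implyP/(_ (A_s iA))/eqP <- := cw (s i); rewrite sK.
Qed.

(* An almost equivariant colouring is determined, up to a Hamming ball, by its
   restriction to [A], and also by its restriction to the complement of [A].
   Gluing the two halves of a pair of such colourings with the same profile on
   [A] stays in the type class, so there are about the square root of
   [#|type_class c|] of them for each profile. *)
Lemma card_type_class_equivariant c :
  #|[set c' in type_class c | equivariant c']| ^ 2 <=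
  ((n.+1 ^ #|K|) * (#|K| * ball_bound t)) ^ 2 * #|type_class c|.
Proof.
set Z := [set c' in _ | _]; set B := #|K| * ball_bound t.
have K_gt0 : 0 < #|K| by apply/card_gt0P; exists (c (Ordinal n_gt0)).
pose Za a := [set c' in Z | profile A c' == a].
have -> : #|Z| = \sum_(a in [set: {ffun K -> 'I_n.+1}]) #|Za a|.
  rewrite -sum1_card (partition_big (profile A) (mem [set: {ffun K -> 'I_n.+1}])) /=.
    apply: eq_bigr => a _; rewrite sum1_card; apply: eq_card => c'.
    by rewrite [LHS]unfold_in [RHS]inE.
  by move=> *; rewrite inE.
have -> : n.+1 ^ #|K| = #|[set: {ffun K -> 'I_n.+1}]|.
  by rewrite cardsT card_ffun card_ord.
rewrite expnMn -mulnA; apply: leq_sqr_sum => a _.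
(* Both members of a pair have profile [a] on [A], so exchanging their [A] halves keeps the total
   profile. Over a given [w], the first member is fixed on [A] and the second off [A]. *)
pose glue (p : {ffun 'I_n -> K} * {ffun 'I_n -> K}) : {ffun 'I_n -> K} :=
  [ffun i => if i \in A then p.1 i else p.2 i].
have glueP p : p \in setX (Za a) (Za a) -> glue p \in type_class c.
  case: p => z1 z2; rewrite !inE /=.
  move=> /andP[/andP[/andP[/eqP t1 _] /eqP a1] /andP[/andP[/eqP t2 _] /eqP a2]].
  have split (z : {ffun 'I_n -> K}) k :
      profile setT z k = profile A z k + profile (~: A) z k :> nat.
    rewrite !profileE -(cardsID A); congr (_ + _); apply: eq_card => i; rewrite !inE.
      by rewrite andbC.
    by rewrite andbC.
  apply/eqP/ffunP => k; apply: val_inj; rewrite /= split.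
  have -> : profile A (glue (z1, z2)) k = profile A z2 k :> nat.
    rewrite a2 -a1 !profileE; apply: eq_card => i; rewrite !inE ffunE inE.
    by case: (i < s i).
  have -> : profile (~: A) (glue (z1, z2)) k = profile (~: A) z2 k :> nat.
    rewrite !profileE; apply: eq_card => i; rewrite !inE ffunE inE.
    by case: (i < s i).
  by rewrite -split t2.
rewrite -mulnn -cardsX -sum1_card (partition_big glue (mem (type_class c))) //=.
rewrite mulnC -sum_nat_const; apply: leq_sum => w _.
rewrite sum1_card -mulnn.
apply: leq_trans (leq_mul (card_equivariant_A w) (card_equivariant_NA w K_gt0)).
rewrite -cardsX; apply/subset_leq_card/subsetP => -[z1 z2].
rewrite inE => /andP[/setXP[]]; rewrite !inE /=.
move=> /andP[/andP[_ e1] _] /andP[/andP[_ e2] _] /eqP/ffunP gw.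
rewrite e1 e2 /=; apply/andP; split; apply/forallP => i; apply/implyP => iA;
  by have := gw i; rewrite ffunE ?iA ?(negPf iA) => ->.
Qed.
End FixedInvolution.

Lemma mismatch_conj c s r :
  #|mismatch (recolour (recolour c r) s) (twist (recolour c r))| =
  #|mismatch (recolour c (s ^ r)%g) (twist c)|.
Proof.
rewrite -(card_imset _ (@perm_inj _ r)); apply: eq_card => i.
apply/imsetP/idP => [[i' + ->]|].
  by rewrite !inE !ffunE conjgE !permM permK.
by rewrite !inE !ffunE conjgE !permM => H; exists (r^-1%g i); rewrite ?permKV // !inE !ffunE permKV.
Qed.

(* [I] being closed under conjugation, [s] may be fixed and [c] moved in its
   type class instead: double count the compatible pairs. *)
Lemma card_matchings_involutions (I : {set {perm 'I_n}}) c t :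
  0 < n -> t <= n ->
  (forall s r, s \in I -> (s ^ r)%g \in I) ->
  (forall s, s \in I -> involutive s /\ #|[set i | s i == i]| <= 1) ->
  #|I :&: matchings (twist c) c t| ^ 2 * #|type_class c| <=
  (#|I| * (n.+1 ^ #|K| * (#|K| * ball_bound t))) ^ 2.
Proof.
move=> n_gt0 tn conjI invI.
set P := n.+1 ^ #|K| * _; set N := #|_ :&: _|.
have count : N * #|type_class c| =
    \sum_(s in I) #|[set c' in type_class c | s \in matchings (twist c') c' t]|.
  transitivity (\sum_(c' in type_class c) #|I :&: matchings (twist c') c' t|).
    rewrite mulnC -sum_nat_const; apply: eq_bigr => _ /type_classP[r ->].
    rewrite /N -[RHS](card_imset _ (@conjg_inj _ r)); apply: eq_card => s.
    have conjI' u q : ((u ^ q)%g \in I) = (u \in I).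
      by apply/idP/idP => [/conjI-/(_ q^-1%g)|/conjI //]; rewrite conjgK.
    apply/idP/imsetP => [|[s' + ->]].
      rewrite !inE => /andP[sI m]; exists (s ^ r^-1)%g; last by rewrite conjgKV.
      by rewrite !inE conjI' sI mismatch_conj conjgKV.
    by rewrite !inE conjI' mismatch_conj.
  under eq_bigr do rewrite -sum1_card.
  under [RHS]eq_bigr do rewrite -sum1_card.
  rewrite (exchange_big_dep (mem I)) /= => [|c' s _]; last by rewrite inE => /andP[].
  by apply: eq_bigr => s sI; apply: eq_bigl => c'; rewrite !inE sI.
have : (N * #|type_class c|) ^ 2 <= #|I| ^ 2 * (P ^ 2 * #|type_class c|).
  rewrite count; apply: leq_sqr_sum => s /invI[sK f1].
  apply: leq_trans (card_type_class_equivariant sK f1 tn n_gt0 c).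
  by rewrite leq_sqr //; apply/subset_leq_card/subsetP => c'; rewrite !inE.
rewrite mulnA -expnMn (expnMn N) -[#|type_class c| ^ 2]mulnn mulnA.
by rewrite leq_pmul2r // card_type_class_gt0.
Qed.

End Involution.
End Colourings.

(** * Binomial coefficients *)

Section Binomials.
Local Open Scope nat_scope.

Lemma leq_bin_exp2 n k : 'C(n, k) <= 2 ^ n.
Proof.
have [kn|nk] := leqP k n; last by rewrite bin_small.
rewrite -[2]/(1 + 1) expnDn (bigD1 (Ordinal (kn : k < n.+1))) //= !exp1n !muln1.
exact: leq_addr.
Qed.

(** A substitute for Stirling's formula: [t ^ t] is at most the falling factorial from [2 t] down to
    [t + 1], which is ['C(2 t, t)] times the factorial of [t]. *)
Lemma leq_exp_self_fact t : t ^ t <= 4 ^ t * t`!.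
Proof.
apply: (@leq_trans ('C(2 * t, t) * t`!)).
  rewrite bin_ffact ffact_prod -{2}[t]card_ord -prod_nat_const.
  by apply: leq_prod => i _; have := ltn_ord i; lia.
by rewrite leq_mul2r; apply/orP; right; rewrite -[4]/(2 ^ 2) -expnM leq_bin_exp2.
Qed.

Lemma leq_bin_mul_exp n t : 'C(n, t) * t ^ t <= (4 * n) ^ t.
Proof.
apply: leq_trans (leq_mul (leqnn _) (leq_exp_self_fact t)) _.
rewrite mulnCA bin_ffact expnMn leq_mul2l; apply/orP; right.
have -> : n ^ t = \prod_(i < t) n by rewrite prod_nat_const card_ord.
rewrite ffact_prod.
by apply: leq_prod => i _; apply: leq_subr.
Qed.

(** The division-free form of [(n / m) ^ m <= 'C(n, m)]; the induction uses
    [(n + 1) / (m + 1) <= n / m] for [m <= n]. *)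
Lemma leq_exp_bin_mul n m : m <= n -> n ^ m <= 'C(n, m) * m ^ m.
Proof.
elim: m n => [|m IH] [|n] // mn.
have {}IH := IH n mn.
rewrite expnS [m.+1 ^ _]expnS mulnA [_ * m.+1]mulnC -mul_bin_diag -mulnA leq_mul2l /=.
have [->|m0] := posnP m; first by rewrite bin0.
rewrite -(@leq_pmul2r (m ^ m)) ?expn_gt0 ?m0 //.
apply: (@leq_trans (n ^ m * m.+1 ^ m)).
  by rewrite -!expnMn leq_exp2r //; nia.
by rewrite mulnAC leq_mul2r IH orbT.
Qed.

Lemma leq_exp2r_weak a b e : a <= b -> a ^ e <= b ^ e.
Proof. by move=> ab; case: e => // e; rewrite leq_exp2r. Qed.

Lemma leq_bin_half n a b : a <= b -> 2 * b <= n -> 'C(n, a) <= 'C(n, b).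
Proof.
elim: b => [|b IH]; first by rewrite leqn0 => /eqP ->.
rewrite leq_eqVlt => /orP[/eqP -> //|ab] bn.
apply: leq_trans (IH _ _) _ => //; first by lia.
rewrite -(@leq_pmul2l b.+1) // mul_bin_left leq_mul2r; apply/orP; right; lia.
Qed.

Lemma exp2_dominates (D q : nat) :
  exists2 L, D <= L & (4 * q * L) ^ D <= 2 ^ (L - D).
Proof.
(* [L] is a power of two, so only exponents are compared: one is at most quadratic in [b], the other
   at least about [b.+1 ^ 3]. *)
pose b := D + q + 3; exists (2 ^ (3 * b)).
  by apply: leq_trans (ltnW (ltn_expl (3 * b) (ltnSn 1))); rewrite /b; lia.
have hb : D * (q + 3 + 3 * b) <= 2 ^ (3 * b).
  have h : b.+1 <= 2 ^ b by apply: ltn_expl.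
  rewrite [3 * b in X in _ <= X]mulnC expnM.
  apply: (@leq_trans (b.+1 ^ 3)); last by rewrite leq_exp2r.
  by rewrite /b !expnS expn0; nia.
have hq : 4 * q <= 2 ^ (q + 2) by have := @ltn_expl 2 q isT; rewrite expnD; lia.
apply: (@leq_trans (2 ^ ((q + 2 + 3 * b) * D))).
  by rewrite (expnM 2 _ D) leq_exp2r_weak // expnD leq_mul2r hq orbT.
by rewrite leq_exp2l //; lia.
Qed.

(** Any fixed power of the volume of a ball of radius [t = k %/ L] is absorbed by ['C(n, k)] once
    [L] is large: compare [(4 q n / t) ^ (t D)] with [(n / (L t)) ^ (L t)]. *)
Lemma bin_dominates (D q : nat) :
  exists2 L, 0 < L & forall n k, 2 * k <= n ->
    ('C(n, k %/ L) * q ^ (k %/ L)) ^ D <= 'C(n, k).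
Proof.
have [->|D0] := posnP D.
  by exists 1 => // n k kn; rewrite expn0 bin_gt0; lia.
have [L DL hL] := exp2_dominates D q.
exists L; first by lia.
move=> n k kn; set t := k %/ L.
have [t0|t0] := posnP t.
  by rewrite t0 bin0 expn0 mul1n exp1n bin_gt0; lia.
have Ltk : L * t <= k by rewrite mulnC leq_divM.
apply: leq_trans (leq_bin_half Ltk kn).
have Ln : L * t <= n by lia.
have L0 : 0 < L by lia.
have h1 : ('C(n, t) * q ^ t) ^ D * t ^ (t * D) <= (4 * q * n) ^ (t * D).
  rewrite (expnM t) (expnM (4 * q * n)) -expnMn leq_exp2r //.
  rewrite mulnAC [4 * q * n]mulnAC (expnMn (4 * n)) leq_mul2r.
  by rewrite leq_bin_mul_exp orbT.
have h2 := leq_exp_bin_mul Ln.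
have h3 : (4 * q * n) ^ (t * D) * (L * t) ^ (L * t) <= n ^ (L * t) * t ^ (t * D).
  have ex x y : x ^ (t * y) = (x ^ y) ^ t by rewrite mulnC expnM.
  have ex' x : x ^ (L * t) = (x ^ L) ^ t by rewrite expnM.
  rewrite !ex !ex' -!expnMn leq_exp2r_weak //.
  (* After [t]-th roots are taken, [n >= 2 L t] provides the factor [2 ^ (L - D)], which pays for
     [(4 q L) ^ D]. *)
  have nL : 2 * L * t <= n by lia.
  have -> : n ^ L = n ^ D * n ^ (L - D) by rewrite -expnD subnKC.
  have -> : (L * t) ^ L = (L * t) ^ D * (L * t) ^ (L - D) by rewrite -expnD subnKC.
  apply: (@leq_trans (n ^ D * (2 * L * t) ^ (L - D) * t ^ D)); last first.
    by rewrite leq_mul2r leq_mul2l leq_exp2r_weak ?orbT.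
  have AC1 (a b c e g : nat) : a * b * (c * e * g) = a * c * (g * (b * e)) by ring.
  have AC2 (a b c e : nat) : a * (b * c) * e = b * (c * (a * e)) by ring.
  rewrite -(mulnA 2) (expnMn 2) AC2.
  rewrite (expnMn (4 * q) n) (expnMn L t D) AC1 -(expnMn (4 * q) L).
 by rewrite leq_mul2r hL orbT.
have pos : 0 < t ^ (t * D) * (L * t) ^ (L * t) by rewrite muln_gt0 !expn_gt0 muln_gt0 L0 t0.
rewrite -(leq_pmul2r pos) mulnA.
apply: leq_trans (leq_mul h1 (leqnn _)) _; apply: leq_trans h3 _.
by rewrite [X in _ <= _ * X]mulnC mulnA leq_mul2r h2 orbT.
Qed.

End Binomials.

(** * Compatible permutation assignments *)

Section Assignments.
Local Open Scope nat_scope.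
Variables (V E : finType) (tl hd : E -> V) (inv : E -> E) (n : nat).
Hypotheses (invK : involutive inv) (hd_inv : forall e, hd e = tl (inv e)).
Implicit Type sigma : {ffun E -> {perm 'I_n}}.

Definition half_loop_perms : {set {perm 'I_n}} :=
  [set s : {perm 'I_n} | (s * s == 1)%g && (#|[set i | s i == i]| == odd n)].

Definition edge_perms e : {set {perm 'I_n}} :=
  if inv e == e then half_loop_perms else setT.

(** One directed edge of each inverse pair, and every half-loop: the places where choices are
    free. *)
Definition edge_reps : {set E} := [set e | enum_rank e <= enum_rank (inv e)].

Lemma edge_reps_inv e : e \notin edge_reps -> inv e \in edge_reps.
Proof. by rewrite !inE invK -ltnNge => /ltnW. Qed.

Lemma edge_reps_both e : e \in edge_reps -> inv e \in edge_reps -> inv e = e.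
Proof.
rewrite !inE invK => h1 h2; apply: enum_rank_inj; apply/val_inj/anti_leq.
by rewrite h1 h2.
Qed.

Lemma assignmentsP sigma : reflect
  ((forall e, sigma (inv e) = (sigma e)^-1%g) /\ (forall e, sigma e \in edge_perms e))
  (sigma \in assignments inv n).
Proof.
rewrite inE; apply: (iffP andP) => -[h1 h2]; split.
- by move=> e; apply/eqP; move/forallP: h1.
- move=> e; rewrite /edge_perms; case: ifP => [ie|]; last by rewrite inE.
  by rewrite inE; move/forallP/(_ e)/implyP: h2; apply.
- by apply/forallP => e; rewrite h1.
- apply/forallP => e; apply/implyP => ie; have := h2 e.
  by rewrite /edge_perms ie inE.
Qed.

Lemma card_pfamily_prod (Q : E -> {set {perm 'I_n}}) :
  #|pfamily 1%g (mem edge_reps) Q| = \prod_(e in edge_reps) #|Q e|.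
Proof. by rewrite card_pfamily foldrE big_map -big_enum. Qed.

(** An assignment is determined by its values on [edge_reps], so restriction is injective. *)
Lemma leq_card_assignments (Q : E -> {set {perm 'I_n}}) :
  #|[set sigma in assignments inv n | [forall e, sigma e \in Q e]]| <=
  \prod_(e in edge_reps) #|edge_perms e :&: Q e|.
Proof.
rewrite -card_pfamily_prod.
pose f sigma : {ffun E -> {perm 'I_n}} :=
  [ffun e => if e \in edge_reps then sigma e else 1%g].
rewrite -(@card_in_imset _ _ f) => [|s1 s2].
  apply/subset_leq_card/subsetP => _ /imsetP[s + ->].
  rewrite inE => /andP[/assignmentsP[_ sF] /forallP sQ].
  apply/pfamilyP; split.
    by apply/subsetP => e; rewrite inE /= ffunE; case: ifP => //; rewrite eqxx.
  by move=> e er; rewrite ffunE er inE sF sQ.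
case/setIdP => /assignmentsP[i1 _] _ /setIdP[/assignmentsP[i2 _] _].
move=> /ffunP e12; apply/ffunP => e.
have [er|/edge_reps_inv er] := boolP (e \in edge_reps).
  by have := e12 e; rewrite !ffunE er.
by have := e12 (inv e); rewrite !ffunE er i1 i2 => /invg_inj.
Qed.

(** Every choice on [edge_reps] extends to an assignment; on a half-loop the inverse condition holds
    because the permutation squares to one. *)
Lemma geq_card_assignments :
  \prod_(e in edge_reps) #|edge_perms e| <= #|assignments inv n|.
Proof.
rewrite -card_pfamily_prod.
pose f (s : {ffun E -> {perm 'I_n}}) : {ffun E -> {perm 'I_n}} :=
  [ffun e => if e \in edge_reps then s e else (s (inv e))^-1%g].
rewrite -(@card_in_imset _ _ f) => [|s1 s2 /pfamilyP[/subsetP p1 _] /pfamilyP[/subsetP p2 _]].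
  apply/subset_leq_card/subsetP => _ /imsetP[s /pfamilyP[_ sF] ->].
  apply/assignmentsP; split=> e; rewrite !ffunE.
    case: ifPn => [ier|/edge_reps_inv]; last by rewrite !invK => ->; rewrite ?invgK.
    case: ifPn => [er|]; last by rewrite invgK.
    have ie := edge_reps_both er ier; have := sF e er.
    rewrite ie /edge_perms ie eqxx inE => /andP[/eqP ss _].
    by apply: (mulgI (s e)); rewrite ss mulgV.
  case: ifPn => [/sF //|/[dup] er /edge_reps_inv ier].
  rewrite /edge_perms; case: eqP => [ie|_]; last by rewrite inE.
  by rewrite ie (negPf er) in ier.
move=> /ffunP e12; apply/ffunP => e.
have [er|er] := boolP (e \in edge_reps).
  by have := e12 e; rewrite !ffunE er.
have : s1 e == 1%g by apply: contraNT er => h; apply: p1; rewrite inE.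
have : s2 e == 1%g by apply: contraNT er => h; apply: p2; rewrite inE.
by move=> /eqP -> /eqP ->.
Qed.

Lemma half_loop_perms_conj s r : s \in half_loop_perms -> (s ^ r)%g \in half_loop_perms.
Proof.
rewrite !inE => /andP[/eqP ss /eqP <-]; rewrite -conjMg ss conj1g eqxx /=.
apply/eqP; rewrite -[RHS](card_imset _ (@perm_inj _ r)) /=; apply: eq_card => i.
apply/idP/imsetP => [|[i' + ->]].
  rewrite inE conjgE !permM => /eqP h; exists (r^-1%g i); last by rewrite permKV.
  by rewrite inE -{2}h permK.
by rewrite !inE conjgE !permM permK => /eqP ->.
Qed.

Lemma half_loop_permsP s : s \in half_loop_perms ->
  involutive s /\ #|[set i | s i == i]| <= 1.
Proof.
rewrite inE => /andP[/eqP ss /eqP ->]; split; last by case: (odd n).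
by move=> i; rewrite -permM ss perm1.
Qed.

Variables (K : finType) (tau : K -> K) (d t : nat).
Hypotheses (tauK : involutive tau) (reg : gregular tl d) (n_gt0 : 0 < n) (tn : t <= n).
Hypothesis K_gt0 : 0 < #|K|.

Definition compatible (c : V -> {ffun 'I_n -> K}) : {set {ffun E -> {perm 'I_n}}} :=
  [set sigma in assignments inv n |
    [forall e, sigma e \in matchings (twist tau (c (tl e))) (c (hd e)) t]].

(** The half-loop bound, being the weaker one, serves for all edges. *)
Definition edge_factor := n.+1 ^ #|K| * (#|K| * ball_bound n K t).

Lemma edge_factor_gt0 : 0 < edge_factor.
Proof. by rewrite /edge_factor muln_gt0 expn_gt0 /= muln_gt0 K_gt0; apply: ball_bound_gt0. Qed.

Lemma prod_tl (f : V -> nat) : \prod_e f (tl e) = \prod_v f v ^ d.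
Proof.
rewrite (partition_big tl predT) //=; apply: eq_bigr => v _.
rewrite -(reg v) /gdeg cardsE -prod_nat_const.
by apply: eq_bigr => e /eqP ->.
Qed.

Lemma prod_edge_reps (f : E -> nat) :
  \prod_e f e = \prod_(e in edge_reps) (if inv e == e then f e else f e * f (inv e)).
Proof.
rewrite (bigID (mem edge_reps)) /=.
have -> : \prod_(e | e \notin edge_reps) f e =
          \prod_(e in edge_reps) (if inv e == e then 1 else f (inv e)).
  rewrite (reindex_inj (inv_inj invK)) /= [RHS](bigID (fun e => inv e == e)) /=.
  rewrite [X in _ = X * _]big1 ?mul1n => [|e /andP[_ ->] //].
  apply: eq_big => e; last first.
    move=> h; rewrite ifN //; apply: contra h => /eqP ie.
    by rewrite inE invK ie.
  apply/idP/andP => [/[dup] h /edge_reps_inv|[h1 h2]].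
    by rewrite invK => er; split=> //; apply: contraNneq h => ->.
  by apply: contra h2 => h; apply/eqP/edge_reps_both.
rewrite -big_split /=; apply: eq_bigr => e _.
by case: ifP; rewrite ?muln1.
Qed.

(** In the squared bounds an ordinary edge contributes the type classes at both its ends and a
    half-loop the one at its vertex: one factor per directed edge, thus [d] per vertex. *)
Lemma card_compatible (c : V -> {ffun 'I_n -> K}) :
  #|compatible c| ^ 2 * \prod_v #|type_class (c v)| ^ d <=
  (#|assignments inv n| * edge_factor ^ #|E|) ^ 2.
Proof.
rewrite -(prod_tl (fun v => #|type_class (c v)|)) prod_edge_reps.
set Q := fun e => matchings (twist tau (c (tl e))) (c (hd e)) t.
have h1 : #|compatible c| <= _ := leq_card_assignments Q.
apply: (@leq_trans ((\prod_(e in edge_reps) (#|edge_perms e| * edge_factor)) ^ 2)); last first.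
  rewrite leq_sqr // big_split /= leq_mul ?geq_card_assignments // prod_nat_const.
  by rewrite leq_pexp2l ?edge_factor_gt0 ?max_card.
have {}h1 : #|compatible c| ^ 2 <= (\prod_(e in edge_reps) #|edge_perms e :&: Q e|) ^ 2.
  by rewrite leq_sqr.
apply: leq_trans (leq_mul h1 (leqnn _)) _.
rewrite -!mulnn -!big_split /=; apply: leq_prod => e _.
rewrite !mulnn /edge_perms; case: eqP => [ie|_].
  rewrite /Q hd_inv ie.
  have := card_matchings_involutions tau (c (tl e)) n_gt0 tn half_loop_perms_conj half_loop_permsP.
  exact.
rewrite setTI cardsT card_Sn /Q hd_inv; apply: leq_trans (card_matchings_sqr _ _ _ _) _ => //.
rewrite leq_sqr // leq_mul2l; apply/orP; right.
by rewrite /edge_factor mulnA leq_pmull // muln_gt0 expn_gt0 K_gt0.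
Qed.

End Assignments.

(** * Summation over all colourings *)

Section UnionBound.
Variables (R : realType) (V E : finType) (tl hd : E -> V) (inv : E -> E) (n : nat).
Hypotheses (invK : involutive inv) (hd_inv : forall e, hd e = tl (inv e)).
Variables (K : finType) (tau : K -> K) (d t : nat).
Hypotheses (tauK : involutive tau) (reg : gregular tl d) (d_ge3 : (3 <= d)%N).
Hypotheses (n_gt0 : (0 < n)%N) (tn : (t <= n)%N) (K_gt0 : (0 < #|K|)%N).

Let M (c : {ffun 'I_n -> K}) : R := #|type_class c|%:R.

Let M_ge1 c : 1 <= M c.
Proof. by rewrite ler1n card_type_class_gt0. Qed.

Let M_gt0 c : 0 < M c.
Proof. exact: lt_le_trans ltr01 (M_ge1 c). Qed.

(** Each type class contributes exactly [1], so the sum counts the profiles that occur. *)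
Lemma sum_inv_type_class : \sum_c (M c)^-1 <= (n.+1 ^ #|K|)%:R.
Proof.
have -> : (n.+1 ^ #|K|)%N = #|{ffun K -> 'I_n.+1}| by rewrite card_ffun card_ord.
rewrite (partition_big (profile setT) predT) //= -sum1_card natr_sum.
apply: ler_sum => a _.
have [e0|[c0]] := set_0Vmem [set c | profile setT c == a].
  by rewrite big_pred0 // => c; move/setP/(_ c): e0; rewrite !inE.
rewrite inE => /eqP c0a.
rewrite (eq_bigr (fun=> (M c0)^-1)) => [|c /eqP ca]; last first.
  congr (_%:R^-1); apply: eq_card => c'; by rewrite !inE ca c0a.
rewrite sumr_const.
have -> : #|[pred c | profile setT c == a]| = #|type_class c0|.
  by apply: eq_card => c; rewrite !inE c0a.
by rewrite -[_ *+ _]mulr_natl -/(M c0) divff // gt_eqF.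
Qed.

Let M_ge0 c : 0 <= M c.
Proof. exact: ltW. Qed.

(* Exponent [d >= 3] leaves one spare factor [sqrt (M (c w))] after spending
   [\prod_v M (c v)] on the sum over all colourings. *)
Lemma card_compatible_real (Q : R) (c : {ffun V -> {ffun 'I_n -> K}}) (w : V) :
  0 <= Q -> Q <= M (c w) ->
  #|compatible tl hd inv tau t c|%:R * Num.sqrt Q <=
  #|assignments inv n|%:R * (edge_factor n K t ^ #|E|)%:R * \prod_v (M (c v))^-1.
Proof.
move=> Q0 Qw; have h := card_compatible invK hd_inv tauK reg n_gt0 tn K_gt0 c.
set g := #|compatible _ _ _ _ _ _| in h *; set A := (#|assignments _ _| * _)%N in h.
rewrite -(ler_nat R) natrM !natrX natr_prod in h.
rewrite -natrM -/A.
have Pi_gt0 : 0 < \prod_v M (c v) by apply: prodr_gt0.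
rewrite prodfV ler_pdivlMr //.
rewrite -ler_sqr ?nnegrE ?mulr_ge0 ?ler0n ?sqrtr_ge0 ?(ltW Pi_gt0) //.
apply: le_trans h.
rewrite !exprMn sqr_sqrtr // -mulrA ler_wpM2l ?exprn_ge0 ?ler0n //.
apply: (@le_trans _ _ (\prod_v (M (c v)) ^+ 3)); last first.
  apply: ler_prod => v _; rewrite exprn_ge0 ?M_ge0 //= natrX.
  by apply: ler_weXn2l; rewrite ?M_ge1.
rewrite prodrXl [X in _ <= X]exprS ler_wpM2r ?exprn_ge0 ?(ltW Pi_gt0) // (le_trans Qw) //.
rewrite (bigD1 w) //= ler_peMr ?M_ge0 //.
by elim/big_ind: _ => // x y; apply: mulr_ege1.
Qed.

Lemma card_union_compatible (Q : R) (C : {set {ffun V -> {ffun 'I_n -> K}}}) :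
  0 <= Q -> (forall c, c \in C -> exists w, Q <= M (c w)) ->
  #|\bigcup_(c in C) compatible tl hd inv tau t c|%:R * Num.sqrt Q <=
  #|assignments inv n|%:R * ((edge_factor n K t) ^ #|E| * n.+1 ^ (#|K| * #|V|))%:R.
Proof.
move=> Q0 CQ.
apply: (@le_trans _ _ (\sum_(c in C) #|compatible tl hd inv tau t c|%:R * Num.sqrt Q)).
  rewrite -mulr_suml ler_wpM2r ?sqrtr_ge0 // -natr_sum ler_nat.
  exact: leq_card_bigcup.
apply: (@le_trans _ _ (\sum_(c : {ffun V -> {ffun 'I_n -> K}})
   #|assignments inv n|%:R * (edge_factor n K t ^ #|E|)%:R * \prod_v (M (c v))^-1)).
  rewrite [X in _ <= X](bigID (mem C)) /= ler_wpDr //.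
    apply: sumr_ge0 => c _; rewrite mulr_ge0 ?mulr_ge0 ?ler0n //.
    by apply: prodr_ge0 => v _; rewrite invr_ge0 ltW.
  by apply: ler_sum => c /CQ[w Qw]; apply: card_compatible_real Qw.
rewrite -mulr_sumr natrM mulrA ler_wpM2l ?mulr_ge0 ?ler0n //.
rewrite -(bigA_distr_bigA (fun (v : V) c => (M c)^-1)) /= prodr_const expnM natrX.
apply: lerXn2r; rewrite ?nnegrE ?ler0n ?sum_inv_type_class //.
by rewrite sumr_ge0 // => c _; rewrite invr_ge0 ltW.
Qed.
End UnionBound.

(** * Fibres of the lift *)

Section Connectivity.
Local Open Scope nat_scope.

(** A path without repeated vertices has fewer than [#|T|] steps. *)
Lemma connect_variation (T : finType) (r : rel T) (P : T -> nat) D :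
  (forall x y, r x y -> P x <= P y + D) ->
  forall x y, connect r x y -> P x <= P y + #|T| * D.
Proof.
move=> step x y /connectP[p0 + ->]; case/shortenP => p pth up _.
have sz : size p < #|T| by have := card_uniqP up; rewrite /= => <-; apply: max_card.
apply: (@leq_trans (P (last x p) + size p * D)); last first.
  by rewrite leq_add2l leq_mul2r ltnW ?orbT.
elim: p x pth {up sz} => [|z p IH] x /=; first by rewrite addn0.
case/andP => /step h /IH h2; apply: leq_trans h _.
by rewrite mulSn addnCA [P z + D]addnC leq_add2l.
Qed.

Variables (W F : finType) (tl hd : F -> W) (inv : F -> F).
Hypotheses (invK : involutive inv) (hd_inv : forall e, hd e = tl (inv e)).

Let dadj := gadj (dtl tl) (dhd hd).

Lemma double_step e b : dadj (tl e, b) (hd e, ~~ b).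
Proof. by apply/existsP; exists (e, b); rewrite /dtl /dhd /= !eqxx. Qed.

Lemma double_connect_sym : connect_sym dadj.
Proof.
apply: sym_connect_sym => x y.
have sym u v : dadj u v -> dadj v u.
  case/existsP => p /andP[/eqP <- /eqP <-]; apply/existsP; exists (dinv inv p).
  by rewrite !(dhd_inv hd_inv) (dinvK invK) !eqxx.
by apply/idP/idP; apply: sym.
Qed.

Lemma double_lift_connect u v b : connect (gadj tl hd) u v ->
  exists b', connect dadj (u, b) (v, b').
Proof.
case/connectP => p + ->; elim: p u b => [|z p IH] u b /=.
  by move=> _; exists b; apply: connect0.
case/andP => /existsP[e /andP[/eqP <- /eqP <-]] /(IH _ (~~ b))[b' h].
by exists b'; apply: connect_trans h; apply/connect1/double_step.
Qed.

(** If no vertex were joined to its other copy, the component of [(v0, false)] would contain exactly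
    one copy of each vertex and define a bipartition. A single vertex joined to its other copy links
    the two sheets. *)
Lemma double_connected : gconnected tl hd -> ~ gbipartite tl hd ->
  gconnected (dtl tl) (dhd hd).
Proof.
move=> conn nbip.
have [v0 hv0] : exists v, connect dadj (v, false) (v, true).
  apply: contrapT => none; apply: nbip.
  have [W0|/card_gt0P[v0 _]] := posnP #|W|.
    by exists (fun=> true) => e; have /card0_eq/(_ (tl e)) := W0.
  exists (fun v => connect dadj (v0, false) (v, true)) => e.
  have cross v : connect dadj (v0, false) (v, true) -> connect dadj (v0, false) (v, false) -> False.
    move=> h1 h2; apply: none; exists v; apply: connect_trans h1.
    by rewrite double_connect_sym.
  have ext b : connect dadj (v0, false) (tl e, b) -> connect dadj (v0, false) (hd e, ~~ b).
    by move=> h; apply: connect_trans h _; apply/connect1/double_step.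
  have [b hb] := double_lift_connect false (conn v0 (tl e)).
  apply/negP => /eqP E; case: b hb => hb.
    by rewrite hb in E; apply: (cross (hd e)) (ext _ hb); rewrite -E.
  by have := ext _ hb; rewrite /= -E => h; apply: cross h hb.
have swap0 b : connect dadj (v0, ~~ b) (v0, b).
  by case: b => //; rewrite double_connect_sym.
move=> [u b] [v c].
have [b1 h1] := double_lift_connect b (conn u v0).
have [c1 h2] := double_lift_connect c (conn v v0).
rewrite double_connect_sym in h2; apply: connect_trans h1 _; apply: connect_trans h2.
have [->|] := eqVneq b1 c1; first exact: connect0.
by case: b1; case: c1 => // _; apply: (swap0 false).
Qed.

(** By lifting paths, the projection of [S] to [W] contains the whole component of each of its
    points. *)
Lemma closed_contains_component (S : {set W * bool}) r :
  (forall p, dtl tl p \in S -> dhd hd p \in S) -> S != set0 ->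
  no_small_component tl hd r -> r <= #|S|.
Proof.
move=> cl /set0Pn[[x b] xS] nsc; apply: leq_trans (nsc x) _.
apply: leq_trans (leq_imset_card fst S).
apply/subset_leq_card/subsetP => y; rewrite inE => /(double_lift_connect b)[b' xy].
apply/imsetP; exists (y, b') => //; move: xy => /connectP[p + ->] {y b'}.
elim: p {x b}(x, b) xS => //= z p IH x xS /andP[/existsP[q /andP[/eqP q1 /eqP q2]]].
by apply: IH; rewrite -q2; apply: cl; rewrite q1.
Qed.
End Connectivity.

(** * Vertex sets in the double cover of a lift *)

Section LiftGraph.
Local Open Scope nat_scope.
Variables (V E : finType) (tl hd : E -> V) (inv : E -> E) (n : nat).
Variable sigma : {ffun E -> {perm 'I_n}}.
Hypotheses (invK : involutive inv) (hd_inv : forall e, hd e = tl (inv e)).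
Hypothesis sigmaV : forall e, sigma (inv e) = (sigma e)^-1%g.

Let ltl := @lift_tl V E tl n.
Let lhd := lift_hd hd sigma.
Let linv := lift_inv inv sigma.

Lemma lift_invK : involutive linv.
Proof. by case=> e i; rewrite /linv /lift_inv /= invK sigmaV permK. Qed.

Lemma lift_hd_inv p : lhd p = ltl (linv p).
Proof. by rewrite /lhd /lift_hd hd_inv. Qed.

Lemma lift_regular d : gregular tl d -> gregular ltl d.
Proof.
move=> reg [v i]; rewrite -(reg v) /gdeg.
rewrite -(card_imset [set e | tl e == v] (f := fun e => (e, i))); last by move=> ? ? [].
apply: eq_card => -[e j]; rewrite !inE; apply/idP/imsetP.
  by rewrite /ltl /lift_tl /= => /eqP[<- <-]; exists e; rewrite ?inE.
by case=> e'; rewrite inE => /eqP <- [-> ->]; rewrite /ltl /lift_tl /=.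
Qed.

Variable S : {set (V * 'I_n) * bool}.
Let bd := edge_boundary (dtl ltl) (dhd lhd) S.

Definition fibre (x : V * bool) : {set 'I_n} := [set i | ((x.1, i), x.2) \in S].

Lemma card_fibres : \sum_x #|fibre x| = #|S|.
Proof.
rewrite -sum1_card.
rewrite (reindex (fun p : (V * bool) * 'I_n => ((p.1.1, p.2), p.1.2))) /=; last first.
  by exists (fun q => ((q.1.1, q.2), q.1.2)) => [[[v b] i]|[[v i] b]].
rewrite -(pair_big_dep predT (fun x i => ((x.1, i), x.2) \in S) (fun _ _ => 1)) /=.
by apply: eq_bigr => x _; rewrite sum1_card; apply: eq_card => i; rewrite !inE.
Qed.

(** [sigma e] carries the fibre over the tail into the fibre over the head, except at points whose
    lifted edge leaves [S]. *)
Lemma fibre_step e b : #|fibre (tl e, b)| <= #|fibre (hd e, ~~ b)| + #|bd|.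
Proof.
rewrite -(cardsID [set i | ((hd e, sigma e i), ~~ b) \in S] (fibre (tl e, b))).
apply: leq_add.
  rewrite -(card_imset _ (@perm_inj _ (sigma e))).
  by apply/subset_leq_card/subsetP => _ /imsetP[i + ->]; rewrite !inE => /andP[].
rewrite -(card_imset _ (f := fun i => ((e, i), b))); last by move=> ? ? [].
apply/subset_leq_card/subsetP => _ /imsetP[i + ->].
by rewrite !inE andbC.
Qed.

Definition swap (p : bool * bool) := (p.2, p.1).
Lemma swapK : involutive swap. Proof. by case. Qed.

(* The colour of a vertex records which of its two copies in the double cover
   lie in [S]. *)
Definition colouring (v : V) : {ffun 'I_n -> bool * bool} :=
  [ffun i => (((v, i), false) \in S, ((v, i), true) \in S)].

(** At a mismatch [i], one of the two copies of the edge [(e, i)] enters or leaves [S]; entering and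
    leaving edges are equally many, hence the factor [2]. *)
Lemma card_colouring_mismatch e :
  #|mismatch (recolour (colouring (hd e)) (sigma e)) (twist swap (colouring (tl e)))|
  <= 2 * #|bd|.
Proof.
pose bd' := [set p | (dtl ltl p \notin S) && (dhd lhd p \in S)].
have -> : 2 * #|bd| = #|bd'| + #|bd|.
  by rewrite /bd' (card_edge_boundaryC (dinvK lift_invK) (dhd_inv lift_hd_inv)) mul2n addnn.
apply: leq_trans (leq_card_setU _ _).
apply: leq_trans (leq_imset_card (fun p : (E * 'I_n) * bool => p.1.2) _).
apply/subset_leq_card/subsetP => i; rewrite inE !ffunE /swap /= => H.
have [b hb] : exists b, (((tl e, i), b) \in S) != (((hd e, sigma e i), ~~ b) \in S).
  apply: contrapT => none; case/negP: H; apply/eqP; congr (_, _); apply/eqP.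
    by rewrite eq_sym; apply/negPn/negP => h; apply: none; exists true.
  by rewrite eq_sym; apply/negPn/negP => h; apply: none; exists false.
apply/imsetP; exists ((e, i), b) => //; rewrite !inE /dtl /dhd /ltl /lhd /lift_tl /lift_hd /=.
by move: hb; case: (_ \in S); case: (_ \in S).
Qed.

(* The smallest fibre has at least half of the average size. *)
Lemma balanced_fibre q r0 L :
  (forall x y, #|fibre x| <= #|fibre y| + #|{: V * bool}| * #|bd|) ->
  no_small_component ltl lhd (2 * #|{: V * bool}| * r0) ->
  S != set0 -> #|S| <= #|{: V * 'I_n}| -> q * #|bd| <= #|S| ->
  2 * #|{: V * bool}| ^ 2 <= q -> 4 * #|{: V * bool}| * L <= q ->
  2 * #|{: V * bool}| * r0 < q -> 0 < L ->
  exists (x : V * bool) (k : nat), [/\ #|fibre x| = k, r0 <= k, 2 * k <= n &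
    2 * #|bd| <= k %/ L].
Proof.
move=> bal nsc S0 Sle qbd q1 q2 q3 L0; set N := #|{: V * bool}| in bal nsc q1 q2 q3 *.
have [[[v0 i0] b0] _] := set0Pn _ S0.
have N0 : 0 < N by apply/card_gt0P; exists (v0, b0).
have Sr : 2 * N * r0 <= #|S|.
  rewrite leqNgt; apply/negP => Slt.
  (* [q * #|bd| <= #|S| < 2 * N * r0 < q] leaves no boundary edge, so [S] is closed and at least as
     large as some component. *)
  have bd0 : #|bd| = 0 by nia.
  have := @closed_contains_component _ _ ltl lhd S _ _ S0 nsc; rewrite leqNgt Slt.
  suff cl p : dtl ltl p \in S -> dhd lhd p \in S by move/(_ cl).
  move=> pS; move/eqP: bd0; rewrite cards_eq0 => /eqP/setP/(_ p).
  by rewrite !inE pS => /negbT; rewrite negbK.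
pose x := [arg min_(x < (v0, b0)) #|fibre x|].
have xmin y : #|fibre x| <= #|fibre y| by rewrite /x; case: arg_minnP => // z _; apply.
have NE : N = #|V| * 2 by rewrite /N card_prod card_bool.
have low : N * #|fibre x| <= #|S|.
  by rewrite -card_fibres /N -sum_nat_const; apply: leq_sum.
have high : #|S| <= N * (#|fibre x| + N * #|bd|).
  by rewrite -card_fibres /N -sum_nat_const; apply: leq_sum => y _; apply: bal.
(* The boundary term of [high] is at most half of [#|S|]. *)
have S2 : #|S| <= 2 * N * #|fibre x|.
  have : 2 * (N ^ 2 * #|bd|) <= #|S|.
    by apply: leq_trans qbd; rewrite mulnA leq_mul2r q1 orbT.
  by move: high; rewrite mulnDr mulnA mulnn; lia.
exists x, #|fibre x|; split=> //.
- by move: (leq_trans Sr S2); rewrite leq_pmul2l // muln_gt0.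
- rewrite card_prod card_ord in Sle; have := leq_trans low Sle; rewrite NE -mulnA leq_pmul2l //.
  by move: N0; rewrite NE; lia.
- rewrite leq_divRL //.
  have : 4 * N * L * #|bd| <= 2 * N * #|fibre x|.
    by apply: leq_trans (leq_trans qbd S2); rewrite leq_mul2r q2 orbT.
  have -> : 4 * N * L * #|bd| = 2 * N * (2 * #|bd| * L) by ring.
  by rewrite leq_pmul2l // muln_gt0.
Qed.
End LiftGraph.

(** * Union bound *)

(** Merging colours by [phi] maps the type class onto all subsets of the given size, each being
    reached by permuting [c]. *)
Lemma leq_bin_type_class n (K : finType) (c : {ffun 'I_n -> K}) (phi : pred K) :
  ('C(n, #|[set i | phi (c i)]|) <= #|type_class c|)%N.
Proof.
set k := #|_|; rewrite -[X in 'C(X, _)]card_ord -card_draws.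
apply: leq_trans (leq_imset_card (fun c' : {ffun 'I_n -> K} => [set i | phi (c' i)]) _).
apply/subset_leq_card/subsetP => A; rewrite inE => /eqP cA.
have /type_classP[s es] : [ffun i => i \in A] \in type_class [ffun i => phi (c i)].
  rewrite inE; apply/eqP/ffunP => b; apply: val_inj; rewrite /= !profileE.
  have cnt (B : {set 'I_n}) (f : {ffun 'I_n -> bool}) : f =1 (fun i => i \in B) ->
      #|[set i in [set: 'I_n] | f i == b]| = (if b then #|B| else n - #|B|)%N.
    move=> fB; transitivity #|if b then B else ~: B|.
      by apply: eq_card => i; rewrite !inE fB; case: b; rewrite ?inE; case: (i \in B).
    by case: b => //; rewrite cardsCs setCK card_ord.
  rewrite (cnt A) => [|i]; last by rewrite ffunE.
  by rewrite (cnt [set i | phi (c i)]) ?cA // => i; rewrite ffunE inE.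
apply/imsetP; exists (recolour c s); first exact: recolour_type_class.
by apply/setP => i; rewrite inE; have /ffunP/(_ i) := es; rewrite !ffunE.
Qed.

Section BadAssignments.
Variables (R : realType) (V E : finType) (tl hd : E -> V) (inv : E -> E) (d : nat).
Hypotheses (invK : involutive inv) (hd_inv : forall e, hd e = tl (inv e)).
Hypotheses (reg : gregular tl d) (d_ge3 : (3 <= d)%N).
Variable L : nat.
Hypothesis Ldom : forall n k, (2 * k <= n)%N ->
  (('C(n, k %/ L) * 4 ^ (k %/ L)) ^ (4 * #|E|) <= 'C(n, k))%N.

Definition colour_class n (c : {ffun 'I_n -> bool * bool}) (b : bool) : {set 'I_n} :=
  [set i | if b then (c i).2 else (c i).1].

Definition bad_colourings n k : {set {ffun V -> {ffun 'I_n -> bool * bool}}} :=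
  [set c : {ffun V -> {ffun 'I_n -> bool * bool}} |
     [exists v, exists b, #|colour_class (c v) b| == k]].

Definition bad_assignments n k : {set {ffun E -> {perm 'I_n}}} :=
  \bigcup_(c in bad_colourings n k) compatible tl hd inv swap (k %/ L) c.

Lemma card_bad_assignments n k a : (0 < n)%N -> (4 * a <= k)%N -> (2 * k <= n)%N ->
  (#|bad_assignments n k| * n ^ a <= #|assignments inv n| *
     (4 ^ #|E| * n.+1 ^ (4 * #|E| + 4 * #|V|) * (4 * a) ^ a))%N.
Proof.
move=> n0 ak kn; have tn : (k %/ L <= n)%N by apply: leq_trans (leq_div _ _) _; lia.
have cK : #|{: bool * bool}| = 4%N by rewrite card_prod card_bool.
pose x : R := ('C(n, k))%:R.
have x1 : 1 <= x by rewrite ler1n bin_gt0; lia.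
have x0 : 0 <= x by apply: le_trans x1.
(* [y] is the fourth root of ['C(n, k)]. Of the two factors [y] in [Num.sqrt x], one absorbs the
   ball volumes of all edges by [Ldom]; the other exceeds [n ^ a] up to a constant, as
   [4 * a <= k]. *)
pose y := Num.sqrt (Num.sqrt x).
have y4 : y ^+ 4 = x by rewrite -[4%N]/(2 * 2)%N exprM !sqr_sqrtr // sqrtr_ge0.
have y0 : 0 <= y by apply: sqrtr_ge0.
have y2 : Num.sqrt x = y ^+ 2 by rewrite sqr_sqrtr // sqrtr_ge0.
have ygt0 : 0 < y.
  rewrite lt_def y0 andbT; apply: contraTneq x1 => yz.
  by rewrite -y4 yz expr0n -ltNge ltr01.
have := @card_union_compatible R V E tl hd inv n invK hd_inv _ swap d (k %/ L)
  swapK reg d_ge3 n0 tn _ x (bad_colourings n k) x0.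
rewrite cK -/(bad_assignments n k) => /(_ isT) H.
have {H} : #|bad_assignments n k|%:R * Num.sqrt x <= #|assignments inv n|%:R *
    (edge_factor n (bool * bool)%type (k %/ L) ^ #|E| * n.+1 ^ (4 * #|V|))%:R.
  apply: H => c; rewrite inE => /existsP[v /existsP[b /eqP ck]]; exists v.
  by rewrite /x -ck ler_nat; apply: (leq_bin_type_class (c v) (fun p => if b then p.2 else p.1)).
rewrite /edge_factor cK /ball_bound cK; set B := ('C(n, _) * _)%N.
have By : (B ^ #|E|)%:R <= y.
  have := Ldom kn; rewrite -/B mulnC expnM -(ler_nat R) natrX -/x -y4.
  by rewrite ler_pXn2r // nnegrE ler0n.
have ny : (n ^ a)%:R <= y * ((4 * a) ^ a)%:R.
  rewrite -(@ler_pXn2r _ 4) ?nnegrE ?mulr_ge0 ?ler0n // exprMn y4 -!natrX -natrM ler_nat.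
  rewrite -!expnM [(a * 4)%N]mulnC; apply: leq_trans (leq_exp_bin_mul _) _; first by lia.
  by rewrite leq_mul2r leq_bin_half ?orbT.
clearbody B.
have -> : ((n.+1 ^ 4 * (4 * B)) ^ #|E| = n.+1 ^ (4 * #|E|) * (4 ^ #|E| * B ^ #|E|))%N.
  by rewrite (expnMn (n.+1 ^ 4)) (expnMn 4 B) (expnM n.+1).
rewrite y2 => H.
set g := #|bad_assignments n k| in H *; set A := #|assignments inv n| in H *.
have {H} H : g%:R * y <= A%:R * (4 ^ #|E| * n.+1 ^ (4 * #|E| + 4 * #|V|))%:R.
  rewrite -(ler_pM2r ygt0) -mulrA -expr2; apply: le_trans H _.
  rewrite -mulrA ler_wpM2l ?ler0n //.
  have -> : (n.+1 ^ (4 * #|E|) * (4 ^ #|E| * B ^ #|E|) * n.+1 ^ (4 * #|V|))%N =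
            (4 ^ #|E| * n.+1 ^ (4 * #|E| + 4 * #|V|) * B ^ #|E|)%N.
    have AC (u v w z : nat) : (u * (v * w) * z = v * (u * z) * w)%N by ring.
    by rewrite expnD AC.
  by rewrite natrM ler_wpM2l ?ler0n.
rewrite -(ler_nat R) (natrM _ g) (natrM _ A) (natrM _ (4 ^ #|E| * _)).
apply: le_trans (ler_wpM2l (ler0n _ g) ny) _.
by rewrite (mulrA g%:R) (mulrA A%:R); apply: ler_wpM2r.
Qed.

(** There are at most [n.+1] values of [k], and [n.+1 <= 2 * n]; so [a = j + p.+1] leaves [n ^ j] in
    the denominator after paying for [n.+1 ^ p.+1]. *)
Lemma lift_prob_le n j p a (P : {ffun E -> {perm 'I_n}} -> Prop) :
  p = (4 * #|E| + 4 * #|V|)%N -> a = (j + p.+1)%N -> (0 < n)%N ->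
  (forall sigma, sigma \in assignments inv n -> P sigma ->
    exists k, [/\ (4 * a <= k)%N, (2 * k <= n)%N & sigma \in bad_assignments n k]) ->
  lift_prob inv R P <= (4 ^ #|E| * 2 ^ p.+1 * (4 * a) ^ a)%:R / n%:R ^+ j.
Proof.
move=> pE aE n0 cov; rewrite /lift_prob.
set X := [set sigma in _ | _]; set A := #|assignments inv n|.
set c := (4 ^ #|E| * 2 ^ p.+1 * (4 * a) ^ a)%N.
have nR : 0 < n%:R ^+ j :> R by rewrite exprn_gt0 // ltr0n.
(* Without assignments the quotient is [0], since the inverse of [0] is [0]. *)
have [->|A0] := posnP A; first by rewrite invr0 mulr0 divr_ge0 ?ler0n ?(ltW nR).
rewrite ler_pdivrMr ?ltr0n // mulrAC ler_pdivlMr // -natrX -!natrM ler_nat.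
have le1 : (#|X| <=
    \sum_(k in [set k : 'I_n.+1 | (4 * a <= k) && (2 * k <= n)]) #|bad_assignments n k|)%N.
  apply: leq_trans (leq_card_bigcup _ _).
  apply/subset_leq_card/subsetP => sigma; rewrite inE.
  move=> /andP[sA /asboolP/(cov _ sA)[k [ak kn kb]]].
  have kn' : (k < n.+1)%N by lia.
  by apply/bigcupP; exists (Ordinal kn'); rewrite ?inE /= ?ak ?kn.
have le2 : (#|X| * n ^ a <= n.+1 * (A * (4 ^ #|E| * n.+1 ^ p * (4 * a) ^ a)))%N.
  apply: leq_trans (leq_mul le1 (leqnn _)) _; rewrite big_distrl /=.
  apply: (@leq_trans (\sum_(k in [set k : 'I_n.+1 | (4 * a <= k) && (2 * k <= n)])
     (A * (4 ^ #|E| * n.+1 ^ p * (4 * a) ^ a)))%N).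
    by apply: leq_sum => k; rewrite inE pE => /andP[ak kn]; apply: card_bad_assignments.
  rewrite sum_nat_const leq_mul2r; apply/orP; right.
  by rewrite -[X in (_ <= X)%N](card_ord n.+1) max_card.
have n2 : (n.+1 ^ p.+1 <= 2 ^ p.+1 * n ^ p.+1)%N by rewrite -expnMn leq_exp2r //; lia.
rewrite -(@leq_pmul2r (n ^ p.+1)) ?expn_gt0 ?n0 // -mulnA -expnD -aE.
apply: leq_trans le2 _.
have -> : (n.+1 * (A * (4 ^ #|E| * n.+1 ^ p * (4 * a) ^ a)) =
  A * (4 ^ #|E| * (4 * a) ^ a) * n.+1 ^ p.+1)%N.
  have AC (u v w z t : nat) : (u * (v * (w * z * t)) = v * (w * t) * (u * z))%N by ring.
  by rewrite expnS AC.
have -> : (c * A * n ^ p.+1 = A * (4 ^ #|E| * (4 * a) ^ a) * (2 ^ p.+1 * n ^ p.+1))%N.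
  have AC (u v w z t : nat) : (u * v * w * z * t = z * (u * w) * (v * t))%N by ring.
  by rewrite /c AC.
by rewrite leq_mul2l n2 orbT.
Qed.

(** The colouring read off from [S] is the witness: a balanced fibre supplies [k], and each edge has
    at most twice the boundary, hence at most [k %/ L], mismatches. *)
Lemma low_expansion_bad n (sigma : {ffun E -> {perm 'I_n}}) q r0
    (S : {set (V * 'I_n) * bool}) :
  sigma \in assignments inv n -> (0 < L)%N ->
  no_small_component (@lift_tl V E tl n) (lift_hd hd sigma) (2 * #|{: V * bool}| * r0) ->
  low_expansion (@lift_tl V E tl n) (lift_hd hd sigma) q S ->
  (forall x y, #|fibre S x| <= #|fibre S y| + #|{: V * bool}| *
     #|edge_boundary (dtl (@lift_tl V E tl n)) (dhd (lift_hd hd sigma)) S|)%N ->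
  (2 * #|{: V * bool}| ^ 2 <= q)%N -> (4 * #|{: V * bool}| * L <= q)%N ->
  (2 * #|{: V * bool}| * r0 < q)%N ->
  exists k, [/\ (r0 <= k)%N, (2 * k <= n)%N & sigma \in bad_assignments n k].
Proof.
move=> sA L0 nsc [S0 Sle qbd] bal q1 q2 q3.
have [sV _] := elimT (assignmentsP _ _) sA.
have [[v b] [k [fk rk kn bk]]] := balanced_fibre bal nsc S0 Sle qbd q1 q2 q3 L0.
exists k; split=> //; apply/bigcupP; exists [ffun v => colouring S v].
  rewrite inE; apply/existsP; exists v; apply/existsP; exists b; rewrite -fk.
  by apply/eqP; apply: eq_card => i; rewrite !inE !ffunE; case: b {fk}.
rewrite inE sA; apply/forallP => e; rewrite inE !ffunE.
exact: leq_trans (card_colouring_mismatch invK hd_inv sV S e) bk.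
Qed.

(** The double cover of [B] is connected, so a path joins any two fibres, and along each step the
    size drops by at most the size of the boundary. *)
Lemma nonbipartite_bad n (sigma : {ffun E -> {perm 'I_n}}) q r0 (s : seq R) i :
  gconnected tl hd -> ~ gbipartite tl hd ->
  sigma \in assignments inv n -> (0 < L)%N ->
  no_small_component (@lift_tl V E tl n) (lift_hd hd sigma) (2 * #|{: V * bool}| * r0) ->
  is_eigenseq (gadjmx (@lift_tl V E tl n) (lift_hd hd sigma) R) s ->
  (0 < i < size s)%N -> d%:R - (q%:R^-1) ^+ 2 / (4 * d%:R) <= `|s`_i| ->
  (2 * #|{: V * bool}| ^ 2 <= q)%N -> (4 * #|{: V * bool}| * L <= q)%N ->
  (2 * #|{: V * bool}| * r0 < q)%N ->
  exists k, [/\ (r0 <= k)%N, (2 * k <= n)%N & sigma \in bad_assignments n k].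
Proof.
move=> conn nbip sA L0 nsc es iS large q1 q2 q3.
have [sV _] := elimT (assignmentsP _ _) sA.
have d0 : (0 < d)%N by lia.
have q0 : (0 < q)%N by lia.
have [S lowS] := nonbipartite_low_expansion (lift_invK invK sV) (lift_hd_inv sigma hd_inv)
  (lift_regular reg) d0 q0 es iS large.
apply: (low_expansion_bad sA L0 nsc lowS) => // x y.
apply: (connect_variation (P := fun z => #|fibre S z|))
  (double_connected invK hd_inv conn nbip x y) => {x y} x y.
case/existsP => -[e b] /andP[/eqP <- /eqP <-].
exact: fibre_step.
Qed.

(** [S] is a union of pairs of copies, so its fibres do not depend on the sheet and paths in [B]
    itself suffice. *)
Lemma bipartite_bad n (sigma : {ffun E -> {perm 'I_n}}) q r0 (s : seq R) i :
  gconnected tl hd -> gbipartite tl hd ->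
  sigma \in assignments inv n -> (0 < L)%N ->
  no_small_component (@lift_tl V E tl n) (lift_hd hd sigma) (2 * #|{: V * bool}| * r0) ->
  is_eigenseq (gadjmx (@lift_tl V E tl n) (lift_hd hd sigma) R) s ->
  (0 < i < size s)%N -> i != (size s).-1 ->
  d%:R - (q%:R^-1) ^+ 2 / (4 * d%:R) <= `|s`_i| ->
  (2 * #|{: V * bool}| ^ 2 <= q)%N -> (4 * #|{: V * bool}| * L <= q)%N ->
  (2 * #|{: V * bool}| * r0 < q)%N ->
  exists k, [/\ (r0 <= k)%N, (2 * k <= n)%N & sigma \in bad_assignments n k].
Proof.
move=> conn [col colP] sA L0 nsc es iS iN large q1 q2 q3.
have [sV _] := elimT (assignmentsP _ _) sA.
have d0 : (0 < d)%N by lia.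
have q0 : (0 < q)%N by lia.
have [S lowS] := bipartite_low_expansion (lift_invK invK sV) (lift_hd_inv sigma hd_inv)
  (lift_regular reg) d0 q0 (col := fun x => col x.1) (fun e => colP e.1) es iS iN large.
apply: (low_expansion_bad sA L0 nsc lowS) => // -[u b] [v c].
have fibreb w b1 b2 : fibre (setX S [set: bool]) (w, b1) = fibre (setX S [set: bool]) (w, b2).
  by apply/setP => i0; rewrite !inE.
rewrite (fibreb u b true) (fibreb v c true).
set D := #|edge_boundary _ _ _|.
apply: (@leq_trans (#|fibre (setX S [set: bool]) (v, true)| + #|V| * D)%N); last first.
  by rewrite leq_add2l leq_mul2r card_prod card_bool leq_pmulr ?orbT.
apply: (connect_variation (P := fun w => #|fibre (setX S [set: bool]) (w, true)|))
  (conn u v) => x y /existsP[e /andP[/eqP <- /eqP <-]].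
by rewrite (fibreb (hd e) true false); apply: fibre_step.
Qed.

End BadAssignments.

(** * Choice of the constants and conclusion *)

Unset Implicit Arguments.

Theorem theorem3p2 (R : realType) (V E : finType) (tl hd : E -> V) (inv : E -> E)
  (d : nat)
  (inv_invol : involutive inv) (hd_inv : forall e, hd e = tl (inv e))
  (Bconn : gconnected tl hd) (Breg : gregular tl d) (d_ge3 : (3 <= d)%N) :
  forall j : nat, (0 < j)%N ->
  exists (eps C : R) (r : nat), 0 < eps /\ 0 < C /\
  forall n : nat, (0 < n)%N ->
    (~ gbipartite tl hd ->
       @lift_prob E inv n R (fun sigma =>
         no_small_component (@lift_tl V E tl n) (lift_hd hd sigma) r /\
         exists s : seq R,
           is_eigenseq (gadjmx (@lift_tl V E tl n) (lift_hd hd sigma) R) s /\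
           exists i : nat, (0 < i < size s)%N /\ d%:R - eps <= `|s`_i|)
       <= C / n%:R ^+ j) /\
    (gbipartite tl hd ->
       @lift_prob E inv n R (fun sigma =>
         no_small_component (@lift_tl V E tl n) (lift_hd hd sigma) r /\
         exists s : seq R,
           is_eigenseq (gadjmx (@lift_tl V E tl n) (lift_hd hd sigma) R) s /\
           exists i : nat, (0 < i < size s)%N /\ i != (size s).-1 /\
             d%:R - eps <= `|s`_i|)
       <= C / n%:R ^+ j).
Proof.
move=> j j0.
have [L L0 Ldom] := bin_dominates (4 * #|E|) 4.
(* [p] is the degree of the polynomial losses; [a] adds the wanted exponent [j] and one more for the
   number of values of [k]. *)
pose p := (4 * #|E| + 4 * #|V|)%N; pose a := (j + p.+1)%N.
pose N := #|{: V * bool}|.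
(* [q] exceeds the three bounds in [q1], [q2] and [q3]. The gap [eps] is the one giving boundary
   ratio [1 / q], and [r] forces a fibre of at least [4 * a] points. *)
pose q := (2 * N ^ 2 + 4 * N * L + 2 * N * (4 * a) + 1)%N.
exists ((q%:R^-1) ^+ 2 / (4 * d%:R)), (4 ^ #|E| * 2 ^ p.+1 * (4 * a) ^ a)%:R,
  (2 * N * (4 * a))%N.
have dR : 0 < d%:R :> R by rewrite ltr0n; lia.
have qR : 0 < q%:R :> R by rewrite ltr0n /q; lia.
split; first by rewrite divr_gt0 ?exprn_gt0 ?invr_gt0 ?mulr_gt0.
split; first by rewrite ltr0n !muln_gt0 !expn_gt0 muln_gt0 /= /a addnS.
have q1 : (2 * N ^ 2 <= q)%N by rewrite /q; lia.
have q2 : (4 * N * L <= q)%N by rewrite /q; lia.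
have q3 : (2 * N * (4 * a) < q)%N by rewrite /q; lia.
move=> n n0.
have bound P := lift_prob_le R inv_invol hd_inv Breg d_ge3 Ldom (P := P)
  (erefl p) (erefl a) n0.
split=> bip; apply: bound.
  move=> sigma sA [nsc [s [es [i [iS large]]]]].
  exact: (nonbipartite_bad inv_invol hd_inv Breg d_ge3 Bconn bip sA L0 nsc es iS large).
move=> sigma sA [nsc [s [es [i [iS [iN large]]]]]].
exact: (bipartite_bad inv_invol hd_inv Breg d_ge3 Bconn bip sA L0 nsc es iS iN large).
Qed.
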